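(* Let $\Phi_1\in \mathscr U$ and $\Phi_2\in \tilde{\mathscr U}$. Assume that $\frac{\Phi_2}{\Phi_1}$ is nondecreasing. Let $\alpha, \beta>-1$ and define for $t\in (0,\infty)$ $$\omega(t)=\frac{\Phi_2^{-1}\left(\frac{1}{t^{2+\beta}}\right)}{\Phi_1^{-1}\left(\frac{1}{t^{2+\alpha}}\right)}.$$ Then: (i) If $\Phi_1$ satisfies the $\nabla_2$-condition and $\omega$ is equivalent to $1$, then $\mathcal{M}\left(A_\alpha^{\Phi_1}(\mathbb{C}_+),A_\beta^{\Phi_2}(\mathbb{C}_+)\right)=H^\infty(\mathbb{C}_+)$. (ii) If $\omega$ is non-decreasing on $(0,\infty)$ and $\lim_{t\rightarrow 0}\omega(t)=0$, then $\mathcal{M}\left(A_\alpha^{\Phi_1}(\mathbb{C}_+),A_\beta^{\Phi_2}(\mathbb{C}_+)\right)=\{0\}$. (iii) If $\Phi_1$ and $\Phi_2\circ\Phi_1^{-1}$ satisfy the $\nabla_2$-condition and $\omega$ is non-increasing on $(0,\infty)$, then $\mathcal{M}\left(A_\alpha^{\Phi_1}(\mathbb{C}_+),A_\beta^{\Phi_2}(\mathbb{C}_+)\right)=\mathcal H_\omega^\infty(\mathbb{C}_+)$.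
   Context: $\mathbb{C}_+=\{x+iy: y>0\}$. A growth function is a continuous nondecreasing function from $[0,\infty)$ onto $[0,\infty)$; $\Phi^{-1}$ is its inverse. $\mathscr{U}^q$ ($q\ge1$) is the set of growth functions $\Phi$ with $\Phi(st)\le Ct^q\Phi(s)$ for $s>0,t\ge1$ and $t\mapsto\Phi(t)/t$ nondecreasing; $\mathscr{U}=\bigcup_{q\ge1}\mathscr{U}^q$. $\tilde{\mathscr U}$ is the set of $\Phi\in\mathscr U^q$ (some $q\ge1$) such that there are constants $C_1,C_2,C_3>0$ with: $\Phi(st)\le C_1\Phi(s)\Phi(t)$ for all $s,t>0$; $\Phi(a/b)\le C_2\Phi(a)/b^q$ for all $a,b\ge1$; $\Phi(a/b)\le C_3\Phi(a)/\Phi(b)$ for all $0<a\le b\le1$. A convex growth function $\Phi$ satisfies the $\nabla_2$-condition if both $\Phi$ and its complementary function $\Psi(s)=\sup_{t\ge0}\{ts-\Phi(t)\}$ satisfy $F(2t)\le KF(t)$ for some $K>1$, all $t\ge0$. For $\gamma>-1$, $dV_\gamma(x+iy)=y^\gamma dxdy$; $A^\Phi_\gamma(\mathbb{C}_+)$: holomorphic $f$ with $\int\Phi(|f|)dV_\gamma<\infty$, with $\|f\|^{lux}_{\Phi,\gamma}=\inf\{\lambda>0:\int\Phi(|f|/\lambda)dV_\gamma\le1\}$. $\mathcal M(X,Y)$ is the set of analytic $g$ on $\mathbb{C}_+$ with $\|fg\|_Y\le C\|f\|_X$ for all $f\in X$, some $C>0$. $H^\infty(\mathbb{C}_+)$: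 bounded analytic functions; $\mathcal H^\infty_\omega(\mathbb{C}_+)$: analytic $f$ with $\sup_{z\in\mathbb{C}_+}|f(z)|/\omega(\Im z)<\infty$. ''$\omega$ equivalent to 1'' means $c\le\omega\le C$ on $(0,\infty)$ for constants $0<c\le C$. *)

(* Defs.v *)
From Stdlib Require Import Reals.
From Coquelicot Require Import Coquelicot.
From mathcomp Require Import all_boot all_algebra.
From mathcomp Require Import all_classical all_reals all_analysis Rstruct Rstruct_topology.

Set Implicit Arguments.
Unset Strict Implicit.
Unset Printing Implicit Defensive.

Local Open Scope classical_set_scope.
Local Open Scope R_scope.

Definition upper (z : C) : Prop := 0 < snd z.

Definition growth (Phi : R -> R) : Prop :=
  (forall t, 0 <= t -> forall eps, 0 < eps -> exists delta, 0 < delta /\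
       forall s, 0 <= s -> Rabs (s - t) < delta -> Rabs (Phi s - Phi t) < eps) /\
  (forall s t, 0 <= s -> s <= t -> Phi s <= Phi t) /\
  (forall t, 0 <= t -> 0 <= Phi t) /\
  (forall y, 0 <= y -> exists t, 0 <= t /\ Phi t = y).

Definition inUq (q : R) (Phi : R -> R) : Prop :=
  growth Phi /\
  (exists C, 0 < C /\ forall s t, 0 < s -> 1 <= t -> Phi (s * t) <= C * Rpower t q * Phi s) /\
  (forall s t, 0 < s -> s <= t -> Phi s / s <= Phi t / t).

Definition inU (Phi : R -> R) : Prop := exists q, 1 <= q /\ inUq q Phi.

Definition inUtilde (Phi : R -> R) : Prop :=
  exists q, 1 <= q /\ inUq q Phi /\
  exists C1 C2 C3, 0 < C1 /\ 0 < C2 /\ 0 < C3 /\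
    (forall s t, 0 < s -> 0 < t -> Phi (s * t) <= C1 * Phi s * Phi t) /\
    (forall a b, 1 <= a -> 1 <= b -> Phi (a / b) <= C2 * Phi a / Rpower b q) /\
    (forall a b, 0 < a -> a <= b -> b <= 1 -> Phi (a / b) <= C3 * Phi a / Phi b).

(* inverse of a growth function: Phi^{-1}(y) = sup {t >= 0 | Phi t <= y};
   for the (strictly increasing, continuous, onto) Phi in U this is the
   genuine inverse on [0, oo). *)
Definition ginv (Phi : R -> R) (y : R) : R := sup [set t : R | 0 <= t /\ Phi t <= y].

Definition convex0 (Phi : R -> R) : Prop :=
  forall x y l, 0 <= x -> 0 <= y -> 0 <= l -> l <= 1 ->
    Phi (l * x + (1 - l) * y) <= l * Phi x + (1 - l) * Phi y.

Definition complementary (Phi : R -> R) (s : R) : \bar R :=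
  ereal_sup [set (t * s - Phi t)%:E | t in [set t : R | 0 <= t]].

Definition doubling (F : R -> R) : Prop :=
  exists K, 1 < K /\ forall t, 0 <= t -> F (2 * t) <= K * F t.

Definition edoubling (F : R -> \bar R) : Prop :=
  exists K, 1 < K /\ forall t, 0 <= t -> (F (2 * t)%R <= K%:E * F t)%E.

Definition nabla2 (Phi : R -> R) : Prop :=
  growth Phi /\ convex0 Phi /\ doubling Phi /\ edoubling (complementary Phi).

Definition holo (f : C -> C) : Prop :=
  forall z, upper z -> Derive.ex_derive (K := C_AbsRing) (V := C_NormedModule) f z.

Definition PhiInt (Phi : R -> R) (gam lam : R) (f : C -> C) : \bar R :=
  (\int[(@lebesgue_measure R \x @lebesgue_measure R)%E]_(z in [set z : C | upper z])
     (Phi (Cmod (f z) / lam) * Rpower (snd z) gam)%:E)%E.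

Definition inA (Phi : R -> R) (gam : R) (f : C -> C) : Prop :=
  holo f /\ (PhiInt Phi gam 1 f < +oo)%E.

Definition lux (Phi : R -> R) (gam : R) (f : C -> C) : R :=
  inf [set lam : R | 0 < lam /\ (PhiInt Phi gam lam f <= 1%:E)%E].

Definition multiplier (Phi1 : R -> R) (al : R) (Phi2 : R -> R) (be : R) (g : C -> C) : Prop :=
  holo g /\ exists C, 0 < C /\ forall f, inA Phi1 al f ->
    inA Phi2 be (fun z => (f z * g z)%C) /\
    lux Phi2 be (fun z => (f z * g z)%C) <= C * lux Phi1 al f.

Definition Hinfty (g : C -> C) : Prop :=
  holo g /\ exists M, forall z, upper z -> Cmod (g z) <= M.

Definition Hinfty_w (w : R -> R) (g : C -> C) : Prop :=
  holo g /\ exists M, forall z, upper z -> Cmod (g z) / w (snd z) <= M.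

Definition omega (Phi1 Phi2 : R -> R) (al be : R) (t : R) : R :=
  ginv Phi2 (/ Rpower t (2 + be)) / ginv Phi1 (/ Rpower t (2 + al)).

(* Main.v *)
(** The second condition in the class of Phi2 forces Phi2(t) to be comparable to t^q. All three
    parts then follow from one statement: g is a multiplier if and only if |g| is bounded by a
    multiple of omega(Im z).

    By the sub-mean value property, a function F with modular at most 1 in the space attached to
    Phi and gamma satisfies |F(x+iy)| <= c Phi^-1(1/y^(2+gamma)).

    Sufficiency: if |f| <= A := Phi1^-1(1/y^(2+alpha)), then Phi2(|f|) <= Phi1(|f|) Phi2(A)/Phi1(A)
    because Phi2/Phi1 is nondecreasing; with Phi2 ~ t^q this gives pointwise
    Phi2(|fg|/C) y^beta <= Phi1(|f|) y^alpha.

    Necessity: the functions A (y0/(z - conj a))^n, with a = x0 + i y0, A = Phi1^-1(1/y0^(2+alpha))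
    and n large, have bounded Luxemburg norm, and the pointwise bound for their product with g,
    taken at a, bounds |g(a)|.

    In part (ii), |g| <= C omega(Im z) makes g vanish at the real line, hence identically. *)

Require Import Defs.
From Stdlib Require Import Reals Lra Lia Psatz.
From Coquelicot Require Import Coquelicot.

Local Open Scope R_scope.

(** * Goursat's theorem on rectangles *)

(** Only comparability up to constants matters, so the classical facts are proved with whatever
    constant comes most easily. Contours are rectangles with sides parallel to the axes: line
    integrals are then ordinary one-dimensional integrals, and averaging a Cauchy estimate over the
    positions of the four sides turns it, by Tonelli, into an area estimate on a square. A function
    of the class U need not be convex. What remains of convexity is that Phi(t)/t is nondecreasing,
    that is, Phi(a s) <= a Phi(s) for 0 <= a <= 1; this gives the mean value inequality for Phi(|F|)
    and moves constants across Phi and its inverse. The comparison of Phi2 with a power is what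
    splits Phi2(|f g|) into a factor coming from f, controlled by the monotone ratio, and one coming
    from g. In the test functions two powers of the kernel pay for integrability in x, and at least
    alpha + 1 further powers for integrability in y at infinity. The vanishing of g in (ii) comes
    from the same Cauchy estimate, used as a crude maximum principle on a square whose lower side
    approaches the real line. *)

Definition loop (P Q : R -> R -> R) (a b c d : R) : R :=
  RInt (fun x => P x c - P x d) a b + RInt (fun y => Q b y - Q a y) c d.

(** The shared [m] says that the form P dx + Q dy, whose counterclockwise circulation is [loop], is
    closed at the point. Only differentiability is asked, with no continuity of the partial
    derivatives. Later P = Im f and Q = Re f, and [loop] is the imaginary part of the contour
    integral of f. *)
Definition closed_at (P Q : R -> R -> R) (x y : R) : Prop :=
  exists l m n, differentiable_pt_lim P x y l m /\ differentiable_pt_lim Q x y m n.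

Lemma differentiable_pt_lim_continuous1 (P : R -> R -> R) x y l m :
  differentiable_pt_lim P x y l m -> continuous (fun t => P t y) x.
Proof.
intros H. assert (H' : differentiable_pt P x y) by (exists l, m; exact H).
apply differentiable_continuity_pt in H'.
apply filterlim_locally; intro eps. destruct (H' eps) as [d Hd]. exists d. intros t Ht.
apply Hd; [exact Ht|rewrite Rminus_eq_0, Rabs_R0; apply cond_pos].
Qed.

Lemma differentiable_pt_lim_continuous2 (P : R -> R -> R) x y l m :
  differentiable_pt_lim P x y l m -> continuous (fun t => P x t) y.
Proof.
intros H. assert (H' : differentiable_pt P x y) by (exists l, m; exact H).
apply differentiable_continuity_pt in H'.
apply filterlim_locally; intro eps. destruct (H' eps) as [d Hd]. exists d. intros t Ht.
apply Hd; [rewrite Rminus_eq_0, Rabs_R0; apply cond_pos|exact Ht].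
Qed.

Lemma closed_at_ex_RInt1 P Q a b c : a <= b ->
  (forall x, a <= x <= b -> closed_at P Q x c) -> ex_RInt (fun x => P x c) a b.
Proof.
intros Hab H. apply (@ex_RInt_continuous R_CompleteNormedModule). intros z Hz.
rewrite Rmin_left in Hz by lra. rewrite Rmax_right in Hz by lra.
destruct (H z Hz) as [l [m [n [H1 _]]]]. exact (differentiable_pt_lim_continuous1 _ _ _ _ _ H1).
Qed.

Lemma closed_at_ex_RInt2 P Q a c d : c <= d ->
  (forall y, c <= y <= d -> closed_at P Q a y) -> ex_RInt (fun y => Q a y) c d.
Proof.
intros Hab H. apply (@ex_RInt_continuous R_CompleteNormedModule). intros z Hz.
rewrite Rmin_left in Hz by lra. rewrite Rmax_right in Hz by lra.
destruct (H z Hz) as [l [m [n [_ H1]]]]. exact (differentiable_pt_lim_continuous2 _ _ _ _ _ H1).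
Qed.

(** Regularity on the boundary alone is enough for the side integrals to exist, so the splitting
    lemmas also apply to a rectangle with a singular point inside. *)
Definition closed_on_sides P Q a b c d :=
  (forall x, a <= x <= b -> closed_at P Q x c /\ closed_at P Q x d) /\
  (forall y, c <= y <= d -> closed_at P Q a y /\ closed_at P Q b y).

Lemma RInt_minus_R f g a b : ex_RInt f a b -> ex_RInt g a b ->
  RInt (fun x => f x - g x) a b = RInt f a b - RInt g a b.
Proof. intros; apply (RInt_minus (V := R_CompleteNormedModule)); assumption. Qed.

Lemma ex_RInt_minus_R (f g : R -> R) a b : ex_RInt f a b -> ex_RInt g a b ->
  ex_RInt (fun x => f x - g x) a b.
Proof. intros; apply (@ex_RInt_minus R_NormedModule); assumption. Qed.

Lemma RInt_Chasles_R f a b c : ex_RInt f a b -> ex_RInt f b c ->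
  RInt f a b + RInt f b c = RInt f a c.
Proof. intros; apply (RInt_Chasles (V := R_CompleteNormedModule)); assumption. Qed.

Lemma loop_split_x P Q a m b c d : a <= m <= b -> c <= d ->
  closed_on_sides P Q a m c d -> closed_on_sides P Q m b c d ->
  loop P Q a b c d = loop P Q a m c d + loop P Q m b c d.
Proof.
intros Hm Hcd [H1 H2] [H3 H4]. unfold loop.
rewrite <- (RInt_Chasles_R _ a m b).
2,3: apply ex_RInt_minus_R; apply closed_at_ex_RInt1 with Q; try lra; intros; solve [apply H1; auto | apply H3; auto].
assert (E1 := closed_at_ex_RInt2 P Q a c d Hcd (fun y Hy => proj1 (H2 y Hy))).
assert (E2 := closed_at_ex_RInt2 P Q m c d Hcd (fun y Hy => proj2 (H2 y Hy))).
assert (E3 := closed_at_ex_RInt2 P Q b c d Hcd (fun y Hy => proj2 (H4 y Hy))).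
rewrite (RInt_minus_R (Q b)), (RInt_minus_R (Q m)), (RInt_minus_R (Q b) (Q m)) by assumption. ring.
Qed.

Lemma loop_split_y P Q a b c m d : a <= b -> c <= m <= d ->
  closed_on_sides P Q a b c m -> closed_on_sides P Q a b m d ->
  loop P Q a b c d = loop P Q a b c m + loop P Q a b m d.
Proof.
intros Hab Hm [H1 H2] [H3 H4]. unfold loop.
rewrite <- (RInt_Chasles_R (fun y => Q b y - Q a y) c m d).
2,3: apply ex_RInt_minus_R; apply closed_at_ex_RInt2 with P; try lra; intros; solve [apply H2; auto | apply H4; auto].
assert (E1 := closed_at_ex_RInt1 P Q a b c Hab (fun y Hy => proj1 (H1 y Hy))).
assert (E2 := closed_at_ex_RInt1 P Q a b m Hab (fun y Hy => proj2 (H1 y Hy))).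
assert (E3 := closed_at_ex_RInt1 P Q a b d Hab (fun y Hy => proj2 (H3 y Hy))).
rewrite (RInt_minus_R (fun x => P x c) (fun x => P x d)), (RInt_minus_R (fun x => P x c) (fun x => P x m)),
  (RInt_minus_R (fun x => P x m) (fun x => P x d)) by assumption. ring.
Qed.

(* On a small rectangle both integrands are constant (the two occurrences of the common partial
   derivative [m]) up to an error of order eps times the diameter, and the constants cancel. *)
Lemma loop_small P Q x y : closed_at P Q x y -> forall eps, 0 < eps ->
  exists del, 0 < del /\ forall a b c d, a <= x <= b -> c <= y <= d -> b - a < del -> d - c < del ->
    closed_on_sides P Q a b c d ->
    Rabs (loop P Q a b c d) <= eps * ((b - a) + (d - c)) ^ 2.
Proof.
intros [l [m [n [HP HQ]]]] eps Heps.
assert (He : 0 < eps / 2) by lra.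
destruct (HP (mkposreal _ He)) as [d1 H1]. destruct (HQ (mkposreal _ He)) as [d2 H2].
exists (Rmin d1 d2). split. { apply Rmin_pos; apply cond_pos. }
intros a b c d Hx Hy Hb Hd [S1 S2].
assert (L1 : Rmin d1 d2 <= d1) by apply Rmin_l. assert (L2 : Rmin d1 d2 <= d2) by apply Rmin_r.
simpl in H1, H2.
assert (B : forall u v, a <= u <= b -> c <= v <= d -> Rmax (Rabs (u - x)) (Rabs (v - y)) <= (b - a) + (d - c)).
{ intros u v Hu Hv. apply Rmax_lub; apply Rabs_le; lra. }
assert (G1 : forall u v, a <= u <= b -> c <= v <= d ->
  Rabs (P u v - P x y - (l * (u - x) + m * (v - y))) <= eps / 2 * ((b - a) + (d - c))).
{ intros u v Hu Hv. eapply Rle_trans; [apply H1; apply Rabs_lt_between; lra|].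
  apply Rmult_le_compat_l; [lra|apply B; auto]. }
assert (G2 : forall u v, a <= u <= b -> c <= v <= d ->
  Rabs (Q u v - Q x y - (m * (u - x) + n * (v - y))) <= eps / 2 * ((b - a) + (d - c))).
{ intros u v Hu Hv. eapply Rle_trans; [apply H2; apply Rabs_lt_between; lra|].
  apply Rmult_le_compat_l; [lra|apply B; auto]. }
assert (Hab : a <= b) by lra. assert (Hcd : c <= d) by lra.
assert (E1 : ex_RInt (fun x => P x c - P x d) a b).
{ apply ex_RInt_minus_R; apply closed_at_ex_RInt1 with Q; auto; intros; apply S1; auto. }
assert (E2 : ex_RInt (fun y => Q b y - Q a y) c d).
{ apply ex_RInt_minus_R; apply closed_at_ex_RInt2 with P; auto; intros; apply S2; auto. }
assert (I1 : Rabs (RInt (fun x => (P x c - P x d) - m * (c - d)) a b) <= (b - a) * (eps * ((b - a) + (d - c)))).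
{ apply abs_RInt_le_const; auto. apply ex_RInt_minus_R; auto. apply ex_RInt_const.
  intros t Ht. assert (K1 := G1 t c Ht (conj (Rle_refl _) Hcd)). assert (K2 := G1 t d Ht (conj Hcd (Rle_refl _))).
  apply Rabs_le_between in K1. apply Rabs_le_between in K2. apply Rabs_le_between. lra. }
assert (I2 : Rabs (RInt (fun y => (Q b y - Q a y) - m * (b - a)) c d) <= (d - c) * (eps * ((b - a) + (d - c)))).
{ apply abs_RInt_le_const; auto. apply ex_RInt_minus_R; auto. apply ex_RInt_const.
  intros t Ht. assert (K1 := G2 b t (conj Hab (Rle_refl _)) Ht). assert (K2 := G2 a t (conj (Rle_refl _) Hab) Ht).
  apply Rabs_le_between in K1. apply Rabs_le_between in K2. apply Rabs_le_between. lra. }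
rewrite RInt_minus_R in I1 by (auto; apply ex_RInt_const).
rewrite RInt_minus_R in I2 by (auto; apply ex_RInt_const).
rewrite RInt_const in I1. rewrite RInt_const in I2.
unfold scal in I1, I2; simpl in I1, I2; unfold mult in I1, I2; simpl in I1, I2.
unfold loop. apply Rabs_le_between in I1. apply Rabs_le_between in I2. apply Rabs_le_between.
nra.
Qed.

(** The point is the supremum of the left endpoints: every right endpoint is an upper bound of all
    of them. *)
Lemma nested_point (u : nat -> R) (w : R) : 0 <= w ->
  (forall n, u n <= u (S n) /\ u (S n) + w / 2 ^ S n <= u n + w / 2 ^ n) ->
  exists x, forall n, u n <= x <= u n + w / 2 ^ n.
Proof.
intros Hw H.
assert (Pw : forall n, 0 <= w / 2 ^ n).
{ intro n. apply Rle_mult_inv_pos; auto. apply pow_lt; lra. }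
assert (M : forall n k, u n <= u (n + k)%nat /\ u (n + k)%nat + w / 2 ^ (n + k) <= u n + w / 2 ^ n).
{ intros n k; induction k as [|k IH]. rewrite Nat.add_0_r; lra.
  rewrite Nat.add_succ_r. destruct (H (n + k)%nat). lra. }
assert (UB : forall n p, u p <= u n + w / 2 ^ n).
{ intros n p. destruct (Nat.le_ge_cases n p) as [L|L].
  - replace p with (n + (p - n))%nat by lia. destruct (M n (p - n)%nat). specialize (Pw (n + (p - n))%nat). lra.
  - destruct (M p (n - p)%nat) as [A B]. replace (p + (n - p))%nat with n in * by lia. specialize (Pw n); lra. }
destruct (completeness (fun y => exists n, y = u n)) as [x [X1 X2]].
- exists (u 0%nat + w / 2 ^ 0). intros y [n ->]. apply UB.
- exists (u 0%nat), 0%nat; auto.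
- exists x. intro n. split. apply X1; exists n; auto. apply X2. intros y [p ->]. apply UB.
Qed.

(** Bisection: among the four quarters of a rectangle one keeps at least a quarter of the
    circulation, while the squared half-perimeter is divided by exactly four. The ratio thus stays
    above a fixed [eps], which contradicts [loop_small] at the common point of the nested
    rectangles. *)
Lemma Goursat_rectangle P Q a b c d : a <= b -> c <= d ->
  (forall x y, a <= x <= b -> c <= y <= d -> closed_at P Q x y) -> loop P Q a b c d = 0.
Proof.
intros Hab Hcd Hcl.
assert (Sides : forall a' b' c' d', a <= a' -> a' <= b' -> b' <= b -> c <= c' -> c' <= d' -> d' <= d ->
  closed_on_sides P Q a' b' c' d').
{ intros; split; intros; split; apply Hcl; lra. }
destruct (Req_dec (loop P Q a b c d) 0) as [|Hne]; auto. exfalso.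
set (w := b - a). set (h := d - c).
assert (Hw : 0 <= w) by (unfold w; lra). assert (Hh : 0 <= h) by (unfold h; lra).
(* The [+ 1] in the denominator covers a rectangle reduced to a point. *)
assert (Heps : exists eps, 0 < eps /\ eps * (w + h) ^ 2 < Rabs (loop P Q a b c d)).
{ apply Rabs_pos_lt in Hne. set (A := Rabs _) in *. set (B := (w + h) ^ 2).
  assert (0 <= B) by (unfold B; nra).
  exists (A / (B + 1)). split. apply Rdiv_lt_0_compat; lra.
  replace (A / (B + 1) * B) with (A - A / (B + 1)) by (field; lra).
  assert (0 < A / (B + 1)) by (apply Rdiv_lt_0_compat; lra). lra. }
destruct Heps as [eps [Heps Hbig]].
set (sub := fun n (p : R * R) => loop P Q (fst p) (fst p + w / 2 ^ n) (snd p) (snd p + h / 2 ^ n)).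
set (bad := fun n p => eps * ((w + h) / 2 ^ n) ^ 2 < Rabs (sub n p)).
(* The first quarter with large circulation is taken, and the fourth one by default; additivity of
   [loop] shows in [Hbad] that the default is large when the other three are not. *)
set (step := fun n (p : R * R) =>
  let w' := w / 2 ^ S n in let h' := h / 2 ^ S n in
  let t := eps * ((w + h) / 2 ^ S n) ^ 2 in
  if Rlt_dec t (Rabs (sub (S n) p)) then p else
  if Rlt_dec t (Rabs (sub (S n) (fst p + w', snd p))) then (fst p + w', snd p) else
  if Rlt_dec t (Rabs (sub (S n) (fst p, snd p + h'))) then (fst p, snd p + h') else
  (fst p + w', snd p + h')).
set (q := fix q n := match n with O => (a, c) | S n => step n (q n) end).
assert (Hpow : forall n, w / 2 ^ n = 2 * (w / 2 ^ S n) /\ h / 2 ^ n = 2 * (h / 2 ^ S n) /\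
   (w + h) / 2 ^ n = 2 * ((w + h) / 2 ^ S n) /\ 0 <= w / 2 ^ S n /\ 0 <= h / 2 ^ S n).
{ intro n. assert (0 < 2 ^ S n) by (apply pow_lt; lra). assert (0 < 2 ^ n) by (apply pow_lt; lra).
  repeat split; try (apply Rle_mult_inv_pos; lra); simpl; field; lra. }
assert (Hstep : forall n p, exists i j, (i = 0 \/ i = 1) /\ (j = 0 \/ j = 1) /\
  step n p = (fst p + i * (w / 2 ^ S n), snd p + j * (h / 2 ^ S n))).
{ intros n p. unfold step. destruct p as [p1 p2]; simpl fst; simpl snd.
  repeat destruct Rlt_dec.
  - exists 0, 0; repeat split; auto; f_equal; ring.
  - exists 1, 0; repeat split; auto; f_equal; ring.
  - exists 0, 1; repeat split; auto; f_equal; ring.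
  - exists 1, 1; repeat split; auto; f_equal; ring. }
assert (Hin : forall n, a <= fst (q n) /\ fst (q n) + w / 2 ^ n <= b /\ c <= snd (q n) /\ snd (q n) + h / 2 ^ n <= d).
{ induction n as [|n IH]. simpl; unfold w, h; lra.
  simpl q. destruct (Hpow n) as [E1 [E2 [E3 [E4 E5]]]].
  destruct (Hstep n (q n)) as [i [j [Hi [Hj ->]]]]. cbv [fst snd]. fold (fst (q n)). fold (snd (q n)).
  destruct Hi, Hj; subst; lra. }
assert (Hbad : forall n, bad n (q n)).
{ induction n as [|n IH].
  - unfold bad, sub; simpl. replace (a + w / 1) with b by (unfold w; field).
    replace (c + h / 1) with d by (unfold h; field). replace ((w + h) / 1) with (w + h) by field. exact Hbig.
  - simpl q. destruct (Hpow n) as [E1 [E2 [E3 [E4 E5]]]].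
    destruct (Hin n) as [N1 [N2 [N3 N4]]].
    unfold bad in IH |- *. revert IH. unfold step.
    destruct (q n) as [p1 p2]; simpl fst in *; simpl snd in *.
    destruct Rlt_dec as [|K1]; [auto|]. destruct Rlt_dec as [|K2]; [auto|].
    destruct Rlt_dec as [|K3]; [auto|]. intro IH.
    assert (Eq : sub n (p1, p2) = sub (S n) (p1, p2) + sub (S n) (p1 + w / 2 ^ S n, p2) +
       sub (S n) (p1, p2 + h / 2 ^ S n) + sub (S n) (p1 + w / 2 ^ S n, p2 + h / 2 ^ S n)).
    { unfold sub. cbv [fst snd]. rewrite E1, E2. rewrite E1 in N2. rewrite E2 in N4.
      set (w' := w / 2 ^ S n) in *. set (h' := h / 2 ^ S n) in *.
      replace (p1 + w' + w') with (p1 + 2 * w') by ring. replace (p2 + h' + h') with (p2 + 2 * h') by ring.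
      rewrite (loop_split_x P Q p1 (p1 + w') (p1 + 2 * w')); try lra; try (apply Sides; lra).
      rewrite (loop_split_y P Q p1 (p1 + w') p2 (p2 + h') (p2 + 2 * h')); try lra; try (apply Sides; lra).
      rewrite (loop_split_y P Q (p1 + w') (p1 + 2 * w') p2 (p2 + h') (p2 + 2 * h')); try lra; try (apply Sides; lra). }
    rewrite Eq in IH. rewrite E3 in IH.
    set (A1 := sub (S n) _) in *. set (A2 := sub (S n) (p1 + _, p2)) in *. set (A3 := sub (S n) (p1, _ + _)) in *.
    set (A4 := sub (S n) (p1 + _, p2 + _)) in *.
    assert (T := Rabs_triang (A1 + A2 + A3) A4). assert (T' := Rabs_triang (A1 + A2) A3).
    assert (T'' := Rabs_triang A1 A2).
    set (t := ((w + h) / 2 ^ S n)) in *. nra. }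
destruct (nested_point (fun n => fst (q n)) w Hw) as [x Hx].
{ intro n. simpl q. destruct (Hpow n) as [E1 [E2 [E3 [E4 E5]]]].
  destruct (Hstep n (q n)) as [i [j [Hi [Hj ->]]]]. cbv [fst snd]. fold (fst (q n)).
  destruct Hi; subst; lra. }
destruct (nested_point (fun n => snd (q n)) h Hh) as [y Hy].
{ intro n. simpl q. destruct (Hpow n) as [E1 [E2 [E3 [E4 E5]]]].
  destruct (Hstep n (q n)) as [i [j [Hi [Hj ->]]]]. cbv [fst snd]. fold (snd (q n)).
  destruct Hj; subst; lra. }
assert (Hx0 := Hx 0%nat). assert (Hy0 := Hy 0%nat). simpl in Hx0, Hy0.
destruct (loop_small P Q x y) with eps as [del [Hdel Hs]]; auto.
{ apply Hcl; [unfold w in Hx0 | unfold h in Hy0]; lra. }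
assert (Hn : exists n, (w + h) / 2 ^ n < del).
{ destruct (Pow_x_infinity 2) with ((w + h) / del + 1) as [n Hn]. rewrite Rabs_pos_eq; lra.
  exists n. specialize (Hn n (le_n n)). assert (0 < 2 ^ n) by (apply pow_lt; lra).
  rewrite Rabs_pos_eq in Hn by lra.
  apply Rmult_lt_reg_r with (2 ^ n); auto.
  replace ((w + h) / 2 ^ n * 2 ^ n) with (w + h) by (field; lra).
  replace (w + h) with ((w + h) / del * del) by (field; lra). nra. }
destruct Hn as [n Hn].
assert (0 < 2 ^ n) by (apply pow_lt; lra).
assert (W0 : 0 <= w / 2 ^ n) by (apply Rle_mult_inv_pos; auto).
assert (H0 : 0 <= h / 2 ^ n) by (apply Rle_mult_inv_pos; auto).
assert (E : (w + h) / 2 ^ n = w / 2 ^ n + h / 2 ^ n) by (field; lra).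
destruct (Hin n) as [N1 [N2 [N3 N4]]].
specialize (Hbad n). unfold bad, sub in Hbad.
specialize (Hs (fst (q n)) (fst (q n) + w / 2 ^ n) (snd (q n)) (snd (q n) + h / 2 ^ n)).
replace (fst (q n) + w / 2 ^ n - fst (q n) + (snd (q n) + h / 2 ^ n - snd (q n))) with ((w + h) / 2 ^ n) in Hs by lra.
assert (K : Rabs (loop P Q (fst (q n)) (fst (q n) + w / 2 ^ n) (snd (q n)) (snd (q n) + h / 2 ^ n)) <= eps * ((w + h) / 2 ^ n) ^ 2).
{ apply Hs; auto; try lra. apply Sides; lra. }
lra.
Qed.

(** * Complex derivatives and Cauchy estimates *)

Definition cderiv (f : C -> C) (z l : C) : Prop :=
  forall eps, 0 < eps -> exists del, 0 < del /\
    forall w, Cmod (w - z) < del -> Cmod (f w - f z - l * (w - z))%C <= eps * Cmod (w - z).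

Lemma cderiv_is_derive f z l : @is_derive C_AbsRing C_NormedModule f z l <-> cderiv f z l.
Proof.
split.
- intros [_ H] eps Heps. specialize (H z (fun P HP => HP) (mkposreal _ Heps)).
  destruct H as [d Hd]. exists d. split; [apply cond_pos|]. intros w Hw.
  specialize (Hd w Hw). simpl in Hd.
  change (Cmod (minus (minus (f w) (f z)) (scal (minus w z) l)) <= eps * Cmod (minus w z)) in Hd.
  replace (f w - f z - l * (w - z))%C with (minus (minus (f w) (f z)) (scal (minus w z) l)); [exact Hd|].
  unfold minus, scal, plus, opp; simpl. unfold mult; simpl. ring.
- intros H. split. apply (is_linear_scal_l (K := C_AbsRing) (V := C_NormedModule)).
  intros x Hx eps. assert (E : z = x) by (apply (is_filter_lim_locally_unique (K:=C_AbsRing) (V:=AbsRing_NormedModule C_AbsRing)); exact Hx).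
  subst x. destruct (H eps (cond_pos eps)) as [d [Hd Hw]].
  exists (mkposreal _ Hd). intros w Hwz. specialize (Hw w Hwz).
  change (Cmod (minus (minus (f w) (f z)) (scal (minus w z) l)) <= eps * Cmod (minus w z)).
  replace (minus (minus (f w) (f z)) (scal (minus w z) l)) with (f w - f z - l * (w - z))%C; [exact Hw|].
  unfold minus, scal, plus, opp; simpl. unfold mult; simpl. ring.
Qed.

Lemma cderiv_const k z : cderiv (fun _ => k) z 0%C.
Proof.
intros eps Heps; exists 1; split; [lra|]. intros w _.
replace (k - k - 0 * (w - z))%C with (RtoC 0) by ring. rewrite Cmod_0.
apply Rmult_le_pos; [lra|apply Cmod_ge_0].
Qed.

Lemma cderiv_affine (p q : C) z : cderiv (fun w => (p * w + q)%C) z p.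
Proof.
intros eps Heps; exists 1; split; [lra|]. intros w _.
replace (p * w + q - (p * z + q) - p * (w - z))%C with (RtoC 0) by ring. rewrite Cmod_0.
apply Rmult_le_pos; [lra|apply Cmod_ge_0].
Qed.

Lemma cderiv_continuous f z l : cderiv f z l ->
  forall eps, 0 < eps -> exists del, 0 < del /\ forall w, Cmod (w - z) < del -> Cmod (f w - f z)%C < eps.
Proof.
intros H eps Heps. destruct (H 1 Rlt_0_1) as [d [Hd Hw]].
assert (M := Cmod_ge_0 l).
exists (Rmin d (eps / (Cmod l + 2))). split. { apply Rmin_pos; auto. apply Rdiv_lt_0_compat; lra. }
intros w Hwz. assert (H1 : Cmod (w - z) < d) by (eapply Rlt_le_trans; [apply Hwz|apply Rmin_l]).
assert (H2 : Cmod (w - z) < eps / (Cmod l + 2)) by (eapply Rlt_le_trans; [apply Hwz|apply Rmin_r]).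
specialize (Hw w H1).
replace (f w - f z)%C with ((f w - f z - l * (w - z)) + l * (w - z))%C by ring.
eapply Rle_lt_trans; [apply Cmod_triangle|]. rewrite Cmod_mult.
assert (0 <= Cmod (w - z)) by apply Cmod_ge_0.
assert (eps = eps / (Cmod l + 2) * (Cmod l + 2)) by (field; lra). nra.
Qed.

Lemma cderiv_mult f g z l m : cderiv f z l -> cderiv g z m ->
  cderiv (fun w => (f w * g w)%C) z (l * g z + f z * m)%C.
Proof.
intros Hf Hg eps Heps.
assert (B1 := Cmod_ge_0 l). assert (B2 := Cmod_ge_0 (g z)). assert (B3 := Cmod_ge_0 (f z)).
set (A := Cmod l + Cmod (g z) + Cmod (f z) + 2). assert (HA : 0 < A) by (unfold A; lra).
set (t := Rmin 1 (eps / (3 * A))).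
assert (Ht : 0 < t). { apply Rmin_pos; [lra|]. apply Rdiv_lt_0_compat; lra. }
assert (Ht1 : t <= 1) by apply Rmin_l.
assert (HtA : t * (3 * A) <= eps).
{ assert (K : t <= eps / (3 * A)) by apply Rmin_r. replace eps with (eps / (3 * A) * (3 * A)) by (field; lra). nra. }
destruct (Hf t Ht) as [d1 [D1 K1]]. destruct (Hg t Ht) as [d2 [D2 K2]].
destruct (cderiv_continuous g z m Hg t Ht) as [d3 [D3 K3]].
exists (Rmin d1 (Rmin d2 d3)). split. { repeat apply Rmin_pos; auto. }
intros w Hw.
assert (M1 := Rmin_l d1 (Rmin d2 d3)). assert (M2 := Rmin_r d1 (Rmin d2 d3)).
assert (M3 := Rmin_l d2 d3). assert (M4 := Rmin_r d2 d3).
specialize (K1 w ltac:(lra)). specialize (K2 w ltac:(lra)). specialize (K3 w ltac:(lra)).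
replace (f w * g w - f z * g z - (l * g z + f z * m) * (w - z))%C with
  ((f w - f z - l * (w - z)) * g w + l * (w - z) * (g w - g z) + f z * (g w - g z - m * (w - z)))%C by ring.
eapply Rle_trans; [apply Cmod_triangle|]. eapply Rle_trans; [apply Rplus_le_compat_r, Cmod_triangle|].
rewrite !Cmod_mult.
assert (G : Cmod (g w) <= Cmod (g z) + 1).
{ replace (g w) with ((g w - g z) + g z)%C by ring. eapply Rle_trans; [apply Cmod_triangle|lra]. }
set (h := Cmod (w - z)) in *. assert (Hh : 0 <= h) by apply Cmod_ge_0.
assert (U := Cmod_ge_0 (g w)).
assert (T1 : Cmod (f w - f z - l * (w - z)) * Cmod (g w) <= t * h * (Cmod (g z) + 1)).
{ apply Rmult_le_compat; auto; apply Cmod_ge_0. }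
assert (T2 : Cmod l * h * Cmod (g w - g z) <= Cmod l * h * t).
{ apply Rmult_le_compat_l; [apply Rmult_le_pos; auto|lra]. }
assert (T3 : Cmod (f z) * Cmod (g w - g z - m * (w - z)) <= Cmod (f z) * (t * h)).
{ apply Rmult_le_compat_l; auto. }
assert (T4 : t * A * h <= eps * h) by (apply Rmult_le_compat_r; nra).
unfold A in T4. nra.
Qed.

Lemma cderiv_comp f g z l m : cderiv f (g z) l -> cderiv g z m -> cderiv (fun w => f (g w)) z (m * l)%C.
Proof.
intros Hf Hg eps Heps. assert (B1 := Cmod_ge_0 l). assert (B2 := Cmod_ge_0 m).
set (A := Cmod l + Cmod m + 2). assert (HA : 0 < A) by (unfold A; lra).
set (t := Rmin 1 (eps / A)).
assert (Ht : 0 < t). { apply Rmin_pos; [lra|]. apply Rdiv_lt_0_compat; lra. }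
assert (Ht1 : t <= 1) by apply Rmin_l.
assert (HtA : t * A <= eps).
{ assert (K : t <= eps / A) by apply Rmin_r. replace eps with (eps / A * A) by (field; lra). nra. }
destruct (Hf t Ht) as [d1 [D1 K1]]. destruct (Hg t Ht) as [d2 [D2 K2]].
destruct (cderiv_continuous g z m Hg d1 D1) as [d3 [D3 K3]].
exists (Rmin d2 d3). split. { apply Rmin_pos; auto. }
intros w Hw. assert (M3 := Rmin_l d2 d3). assert (M4 := Rmin_r d2 d3).
specialize (K2 w ltac:(lra)). specialize (K1 (g w) (K3 w ltac:(lra))).
set (h := Cmod (w - z)) in *. assert (Hh : 0 <= h) by apply Cmod_ge_0.
assert (G : Cmod (g w - g z) <= (Cmod m + 1) * h).
{ replace (g w - g z)%C with ((g w - g z - m * (w - z)) + m * (w - z))%C by ring.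
  eapply Rle_trans; [apply Cmod_triangle|]. rewrite Cmod_mult. fold h. nra. }
replace (f (g w) - f (g z) - m * l * (w - z))%C with
  ((f (g w) - f (g z) - l * (g w - g z)) + l * (g w - g z - m * (w - z)))%C by ring.
eapply Rle_trans; [apply Cmod_triangle|]. rewrite Cmod_mult.
assert (T1 : t * Cmod (g w - g z) <= t * ((Cmod m + 1) * h)) by (apply Rmult_le_compat_l; lra).
assert (T2 : Cmod l * Cmod (g w - g z - m * (w - z)) <= Cmod l * (t * h)) by (apply Rmult_le_compat_l; lra).
assert (T3 : t * A * h <= eps * h) by (apply Rmult_le_compat_r; lra).
unfold A in T3. nra.
Qed.

Lemma cderiv_inv z : z <> RtoC 0 -> cderiv (fun w => (/ w)%C) z (- / (z * z))%C.
Proof.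
intros Hz eps Heps. assert (Hz' := proj1 (Cmod_gt_0 z) Hz). set (r := Cmod z) in *.
(* The remainder is (w - z)^2 / (w z^2). The first radius gives |w| >= r/2, the second then bounds
   the remainder by eps |w - z|. *)
exists (Rmin (r / 2) (eps * (r * r * r) / 2)). split.
{ apply Rmin_pos; [lra|]. assert (0 < r * r * r) by (repeat apply Rmult_lt_0_compat; auto). nra. }
intros w Hw.
assert (H1 : Cmod (w - z) < r / 2) by (eapply Rlt_le_trans; [apply Hw|apply Rmin_l]).
assert (H2 : Cmod (w - z) < eps * (r * r * r) / 2) by (eapply Rlt_le_trans; [apply Hw|apply Rmin_r]).
assert (Hwr : r / 2 <= Cmod w).
{ assert (T := Cmod_triangle w (- (w - z))). replace (w + - (w - z))%C with z in T by ring.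
  rewrite Cmod_opp in T. fold r in T. lra. }
assert (Hw0 : w <> RtoC 0). { apply Cmod_gt_0. lra. }
replace (/ w - / z - - / (z * z) * (w - z))%C with ((w - z) * (w - z) * / (w * (z * z)))%C.
2:{ field; auto. }
rewrite !Cmod_mult, Cmod_inv, !Cmod_mult by (repeat apply Cmult_neq_0; auto). fold r.
set (t := Cmod (w - z)) in *. assert (Ht : 0 <= t) by apply Cmod_ge_0. set (s := Cmod w) in *.
rewrite Rmult_assoc, (Rmult_comm eps). apply Rmult_le_compat_l; auto.
assert (0 < s * (r * r)) by (apply Rmult_lt_0_compat; nra).
apply Rmult_le_reg_r with (s * (r * r)); auto. rewrite Rmult_assoc, Rinv_l by lra.
assert (r / 2 * (r * r) <= s * (r * r)) by (apply Rmult_le_compat_r; nra).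
nra.
Qed.

Lemma Cmod_le_2Rmax z : Cmod z <= 2 * Rmax (Rabs (fst z)) (Rabs (snd z)).
Proof.
assert (S := sqrt_lt_1 2 4 ltac:(lra) ltac:(lra) ltac:(lra)).
replace 4 with (2 * 2) in S by ring. rewrite sqrt_square in S by lra.
eapply Rle_trans; [apply Cmod_2Rmax|]. apply Rmult_le_compat_r; [|lra].
eapply Rle_trans; [apply Rabs_pos|apply Rmax_l].
Qed.

(** The Cauchy-Riemann equations: Im f has gradient (Im l, Re l) and Re f has gradient (Re l, - Im
    l), so the shared entry is Re l. *)
Lemma cderiv_closed_at f z l : cderiv f z l ->
  closed_at (fun x y => Im (f (x, y))) (fun x y => Re (f (x, y))) (Re z) (Im z).
Proof.
intro H. exists (Im l), (Re l), (- Im l). destruct z as [x y]; simpl.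
assert (Key : forall eps : posreal, locally_2d (fun u v => Cmod (f (u, v) - f (x, y) - l * ((u, v) - (x, y)))%C <= eps * Rmax (Rabs (u - x)) (Rabs (v - y))) x y).
{ intro eps. assert (He : 0 < eps / 2) by (assert (K := cond_pos eps); lra).
  destruct (H _ He) as [d [Hd Hw]]. assert (Hd2 : 0 < d / 2) by lra. exists (mkposreal _ Hd2). intros u v Hu Hv. simpl in Hu, Hv.
  assert (B := Cmod_le_2Rmax ((u, v) - (x, y))%C). simpl fst in B; simpl snd in B.
  change (u + - x) with (u - x) in B. change (v + - y) with (v - y) in B.
  assert (M : 0 <= Rmax (Rabs (u - x)) (Rabs (v - y))) by (eapply Rle_trans; [apply Rabs_pos|apply Rmax_l]).
  assert (M2 : Rmax (Rabs (u - x)) (Rabs (v - y)) < d / 2) by (apply Rmax_lub_lt; auto).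
  assert (B2 : Cmod ((u, v) - (x, y)) <= 2 * Rmax (Rabs (u - x)) (Rabs (v - y))) by nra.
  eapply Rle_trans; [apply Hw; lra|]. assert (K := cond_pos eps). nra. }
split; intro eps; destruct (Key eps) as [d Hd]; exists d; intros u v Hu Hv; specialize (Hd u v Hu Hv);
  (eapply Rle_trans; [|exact Hd]).
- eapply Rle_trans; [|eapply Rle_trans; [apply Rmax_r|apply Rmax_Cmod]].
  right; f_equal. destruct l as [l1 l2]. simpl. destruct (f (u, v)), (f (x, y)); simpl. ring.
- eapply Rle_trans; [|eapply Rle_trans; [apply Rmax_l|apply Rmax_Cmod]].
  right; f_equal. destruct l as [l1 l2]. simpl. destruct (f (u, v)), (f (x, y)); simpl. ring.
Qed.

(** Multiplying a function by [e] makes its value at one point real and nonnegative, so that the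
    imaginary part of the contour integral carries all the information needed in the Cauchy
    estimate. *)
Lemma unimodular_to_Cmod (z : C) : exists e : C, Cmod e = 1 /\ (e * z)%C = RtoC (Cmod z).
Proof.
destruct (Req_dec (Cmod z) 0) as [E|E].
- exists (RtoC 1). split; [apply Cmod_1|]. rewrite E. apply Cmod_eq_0 in E. rewrite E. ring.
- exists (Cconj z / Cmod z)%C. assert (RtoC (Cmod z) <> RtoC 0) by (intro K; apply E; injection K; auto).
  split. rewrite Cmod_div, Cmod_conj, Cmod_R, Rabs_pos_eq by (auto; apply Cmod_ge_0). field; auto.
  assert (K := Cmod2_conj z). replace (Cconj z / Cmod z * z)%C with ((z * Cconj z) / Cmod z)%C by (field; auto).
  rewrite <- K. rewrite RtoC_pow. simpl. field; auto.
Qed.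

(* The four rectangles cut off around the small square do not contain its centre. *)
Lemma loop_shrink P Q p q p1 p2 q1 q2 s : 0 < s -> p1 <= p - s -> p + s <= p2 -> q1 <= q - s -> q + s <= q2 ->
  (forall x y, p1 <= x <= p2 -> q1 <= y <= q2 -> x <> p \/ y <> q -> closed_at P Q x y) ->
  loop P Q p1 p2 q1 q2 = loop P Q (p - s) (p + s) (q - s) (q + s).
Proof.
intros Hs H1 H2 H3 H4 Hc.
rewrite (loop_split_x P Q p1 (p - s) p2 q1 q2); try lra.
2,3: split; intros; split; apply Hc; lra.
rewrite (loop_split_x P Q (p - s) (p + s) p2 q1 q2); try lra.
2,3: split; intros; split; apply Hc; lra.
rewrite (loop_split_y P Q (p - s) (p + s) q1 (q - s) q2); try lra.
2,3: split; intros; split; apply Hc; lra.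
rewrite (loop_split_y P Q (p - s) (p + s) (q - s) (q + s) q2); try lra.
2,3: split; intros; split; apply Hc; lra.
rewrite (Goursat_rectangle P Q p1 (p - s) q1 q2), (Goursat_rectangle P Q (p + s) p2 q1 q2),
  (Goursat_rectangle P Q (p - s) (p + s) q1 (q - s)), (Goursat_rectangle P Q (p - s) (p + s) (q + s) q2);
  try lra; intros; apply Hc; lra.
Qed.

Lemma Cdist_fst x y p q : Rabs (x - p) <= Cmod ((x, y) - (p, q)).
Proof. eapply Rle_trans; [|apply Rmax_Cmod]. apply (Rmax_l (Rabs (x - p))). Qed.

Lemma Cdist_snd x y p q : Rabs (y - q) <= Cmod ((x, y) - (p, q)).
Proof. eapply Rle_trans; [|apply Rmax_Cmod]. apply (Rmax_r _ (Rabs (y - q))). Qed.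

Lemma Cminus_eq_0 (z w : C) : (z - w)%C = RtoC 0 -> z = w.
Proof. intro K. replace z with ((z - w) + w)%C by ring. rewrite K. ring. Qed.

Definition holo_at f z := exists l, cderiv f z l.

(* The loop integral of (f z - f c) / (z - c) vanishes: it can be taken over arbitrarily small
   squares around c, near which the integrand is bounded. *)
Lemma loop_slope_zero f (e : C) p q p1 p2 q1 q2 : p1 < p < p2 -> q1 < q < q2 ->
  (forall x y, p1 <= x <= p2 -> q1 <= y <= q2 -> holo_at f (x, y)) ->
  let h := fun z => (e * (f z - f (p, q)) * / (z - (p, q)))%C in
  (forall x y, p1 <= x <= p2 -> q1 <= y <= q2 -> x <> p \/ y <> q -> closed_at (fun x y => Im (h (x, y))) (fun x y => Re (h (x, y))) x y) /\
  loop (fun x y => Im (h (x, y))) (fun x y => Re (h (x, y))) p1 p2 q1 q2 = 0.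
Proof.
intros Hp Hq Hf h. set (P := fun x y => Im (h (x, y))). set (Q := fun x y => Re (h (x, y))).
assert (Hcl : forall x y, p1 <= x <= p2 -> q1 <= y <= q2 -> x <> p \/ y <> q -> closed_at P Q x y).
{ intros x y Hx Hy Hne. destruct (Hf x y Hx Hy) as [l Hl].
  assert (Hz : ((x, y) - (p, q))%C <> RtoC 0).
  { intro K. injection K; intros. destruct Hne as [Hne|Hne]; apply Hne; lra. }
  assert (D1 : cderiv (fun z => (1 * z + - (p, q))%C) (x, y) 1%C) by apply cderiv_affine.
  assert (D2 : cderiv (fun z => (/ (z - (p, q)))%C) (x, y) (1 * - / (((x, y) - (p, q)) * ((x, y) - (p, q))))%C).
  { assert (K := cderiv_comp (fun z => (/ z)%C) (fun z => (1 * z + - (p, q))%C) (x, y)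
      (- / (((x, y) - (p, q)) * ((x, y) - (p, q))))%C 1%C).
    cbv beta in K.
    replace (1 * (x, y) + - (p, q))%C with ((x, y) - (p, q))%C in K by ring.
    assert (K' := K (cderiv_inv _ Hz) D1).
    intros eps He. destruct (K' eps He) as [d [Hd Hw]]. exists d; split; auto. intros w Hwz. specialize (Hw w Hwz).
    cbv beta in Hw |- *. replace (1 * w + - (p, q))%C with (w - (p, q))%C in Hw by ring.
    replace (1 * (x, y) + - (p, q))%C with ((x, y) - (p, q))%C in Hw by ring. exact Hw. }
  assert (D3 := cderiv_comp (fun w => (e * w + - (e * f (p, q)))%C) f (x, y) e l (cderiv_affine _ _ _) Hl).
  assert (D4 := cderiv_mult _ _ _ _ _ D3 D2). cbv beta in D4.
  match type of D4 with cderiv _ _ ?m => assert (D5 : cderiv h (x, y) m) end.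
  { intros eps He. destruct (D4 eps He) as [d [Hd Hw]]. exists d; split; auto. intros w Hwz. specialize (Hw w Hwz).
    unfold h at 1 2. replace (e * (f w - f (p, q)))%C with (e * f w + - (e * f (p, q)))%C by ring.
    replace (e * (f (x, y) - f (p, q)))%C with (e * f (x, y) + - (e * f (p, q)))%C by ring. exact Hw. }
  exact (cderiv_closed_at _ _ _ D5). }
split; auto.
destruct (Hf p q) as [l Hl]; try lra.
destruct (Hl 1 Rlt_0_1) as [d [Hd Hw]].
set (M := Cmod e * (Cmod l + 1)).
assert (HM : 0 <= M). { apply Rmult_le_pos; [apply Cmod_ge_0|]. assert (K := Cmod_ge_0 l); lra. }
assert (Hh : forall z, z <> (p, q) -> Cmod (z - (p, q)) < d -> Cmod (h z) <= M).
{ intros z Hz Hzd. specialize (Hw z Hzd).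
  assert (Hz' : (z - (p, q))%C <> RtoC 0). { intro K. apply Hz. apply Cminus_eq_0; exact K. }
  assert (Hpos := proj1 (Cmod_gt_0 _) Hz').
  unfold h. rewrite !Cmod_mult, Cmod_inv by auto.
  assert (B : Cmod (f z - f (p, q)) <= (Cmod l + 1) * Cmod (z - (p, q))).
  { replace (f z - f (p, q))%C with ((f z - f (p, q) - l * (z - (p, q))) + l * (z - (p, q)))%C by ring.
    eapply Rle_trans; [apply Cmod_triangle|]. rewrite Cmod_mult. lra. }
  unfold M. rewrite Rmult_assoc. apply Rmult_le_compat_l; [apply Cmod_ge_0|].
  apply Rmult_le_reg_r with (Cmod (z - (p, q))); auto. rewrite Rmult_assoc, Rinv_l by lra. lra. }
assert (Small : forall eps, 0 < eps -> Rabs (loop P Q p1 p2 q1 q2) <= eps).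
{ intros eps Heps.
  (* The small square must lie in the rectangle, stay within distance [d] of its centre ([d / 4],
     since [Cmod] is at most twice the maximum norm), and have perimeter 8 s with 8 s M <= eps. *)
  set (s := Rmin (Rmin (Rmin (p - p1) (p2 - p)) (Rmin (q - q1) (q2 - q))) (Rmin (d / 4) (eps / (8 * M + 1)))).
  assert (Hs : 0 < s). { unfold s; repeat apply Rmin_pos; try lra. apply Rdiv_lt_0_compat; lra. }
  assert (Hs' : s <= p - p1 /\ s <= p2 - p /\ s <= q - q1 /\ s <= q2 - q /\ s <= d / 4 /\ s <= eps / (8 * M + 1)).
  { unfold s.
    assert (T1 := Rmin_l (p - p1) (p2 - p)). assert (T2 := Rmin_r (p - p1) (p2 - p)).
    assert (T3 := Rmin_l (q - q1) (q2 - q)). assert (T4 := Rmin_r (q - q1) (q2 - q)).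
    assert (T5 := Rmin_l (d / 4) (eps / (8 * M + 1))). assert (T6 := Rmin_r (d / 4) (eps / (8 * M + 1))).
    set (m1 := Rmin (p - p1) _) in *. set (m2 := Rmin (q - q1) _) in *. set (m3 := Rmin (d / 4) _) in *.
    assert (T7 := Rmin_l m1 m2). assert (T8 := Rmin_r m1 m2).
    assert (T9 := Rmin_l (Rmin m1 m2) m3). assert (T10 := Rmin_r (Rmin m1 m2) m3). repeat split; lra. }
  destruct Hs' as [S1 [S2 [S3 [S4 [S5 S6]]]]].
  rewrite (loop_shrink P Q p q p1 p2 q1 q2 s); auto; try lra.
  assert (HB : forall x y, Rabs (x - p) <= s -> Rabs (y - q) <= s -> x <> p \/ y <> q -> Cmod (h (x, y)) <= M).
  { intros x y Hx Hy Hne. apply Hh. { intro K; injection K; intros; destruct Hne; auto. }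
    eapply Rle_lt_trans; [apply Cmod_le_2Rmax|]. simpl.
      assert (R1 : Rmax (Rabs (x + - p)) (Rabs (y + - q)) <= s) by (apply Rmax_lub; auto).
    assert (R2 : 0 <= Rmax (Rabs (x + - p)) (Rabs (y + - q))) by (eapply Rle_trans; [apply Rabs_pos|apply Rmax_l]).
    nra. }
  assert (HP : forall x y, Rabs (x - p) <= s -> Rabs (y - q) <= s -> x <> p \/ y <> q -> Rabs (P x y) <= M /\ Rabs (Q x y) <= M).
  { intros x y Hx Hy Hne. specialize (HB x y Hx Hy Hne). split; eapply Rle_trans; try exact HB.
    eapply Rle_trans; [apply Rmax_r|apply (Rmax_Cmod (h (x, y)))].
    eapply Rle_trans; [apply Rmax_l|apply (Rmax_Cmod (h (x, y)))]. }
  assert (I1 : Rabs (RInt (fun x => P x (q - s) - P x (q + s)) (p - s) (p + s)) <= (p + s - (p - s)) * (2 * M)).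
  { apply abs_RInt_le_const; try lra. apply ex_RInt_minus_R; apply closed_at_ex_RInt1 with Q; try lra; intros; apply Hcl; lra.
    intros t Ht. destruct (HP t (q - s)) as [K1 _]; try (apply Rabs_le; lra); try lra.
    destruct (HP t (q + s)) as [K2 _]; try (apply Rabs_le; lra); try lra.
    apply Rabs_le_between in K1. apply Rabs_le_between in K2. apply Rabs_le_between. lra. }
  assert (I2 : Rabs (RInt (fun y => Q (p + s) y - Q (p - s) y) (q - s) (q + s)) <= (q + s - (q - s)) * (2 * M)).
  { apply abs_RInt_le_const; try lra. apply ex_RInt_minus_R; apply closed_at_ex_RInt2 with P; try lra; intros; apply Hcl; lra.
    intros t Ht. destruct (HP (p - s) t) as [_ K1]; try (apply Rabs_le; lra); try lra.
    destruct (HP (p + s) t) as [_ K2]; try (apply Rabs_le; lra); try lra.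
    apply Rabs_le_between in K1. apply Rabs_le_between in K2. apply Rabs_le_between. lra. }
  unfold loop. eapply Rle_trans; [apply Rabs_triang|].
  assert (eps = eps / (8 * M + 1) * (8 * M + 1)) by (field; lra).
  assert (0 < eps / (8 * M + 1)) by (apply Rdiv_lt_0_compat; lra). nra. }
destruct (Req_dec (loop P Q p1 p2 q1 q2) 0) as [E|E]; auto.
apply Rabs_pos_lt in E. specialize (Small (Rabs (loop P Q p1 p2 q1 q2) / 2)). lra.
Qed.

Lemma holo_at_Cmod_continuous f x y : holo_at f (x, y) ->
  forall eps, 0 < eps -> exists del, 0 < del /\ forall u v, Rabs (u - x) < del -> Rabs (v - y) < del ->
    Rabs (Cmod (f (u, v)) - Cmod (f (x, y))) < eps.
Proof.
intros [l Hl] eps Heps. destruct (cderiv_continuous _ _ _ Hl eps Heps) as [d [Hd Hw]].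
exists (d / 2); split; [lra|]. intros u v Hu Hv.
assert (K : Cmod ((u, v) - (x, y)) < d).
{ eapply Rle_lt_trans; [apply Cmod_le_2Rmax|]. simpl.
  assert (R1 : Rmax (Rabs (u + - x)) (Rabs (v + - y)) < d / 2) by (apply Rmax_lub_lt; auto).
  assert (R2 : 0 <= Rmax (Rabs (u + - x)) (Rabs (v + - y))) by (eapply Rle_trans; [apply Rabs_pos|apply Rmax_l]).
  nra. }
specialize (Hw _ K). set (a := f (u, v)) in *. set (b := f (x, y)) in *.
assert (T1 := Cmod_triangle (a - b) b). assert (T2 := Cmod_triangle (b - a) a).
replace (a - b + b)%C with a in T1 by ring. replace (b - a + a)%C with b in T2 by ring.
replace (b - a)%C with (- (a - b))%C in T2 by ring. rewrite Cmod_opp in T2.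
apply Rabs_lt_between. lra.
Qed.

Lemma holo_at_continuous_x f x y : holo_at f (x, y) -> continuous (fun t => Cmod (f (t, y))) x.
Proof.
intros H. apply filterlim_locally; intro eps.
destruct (holo_at_Cmod_continuous f x y H eps (cond_pos eps)) as [d [Hd Hw]].
exists (mkposreal _ Hd). intros t Ht. apply Hw; [exact Ht|]. rewrite Rminus_eq_0, Rabs_R0; auto.
Qed.

Lemma holo_at_continuous_y f x y : holo_at f (x, y) -> continuous (fun t => Cmod (f (x, t))) y.
Proof.
intros H. apply filterlim_locally; intro eps.
destruct (holo_at_Cmod_continuous f x y H eps (cond_pos eps)) as [d [Hd Hw]].
exists (mkposreal _ Hd). intros t Ht. apply Hw; [|exact Ht]. rewrite Rminus_eq_0, Rabs_R0; auto.
Qed.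

Lemma ex_RInt_cont (f : R -> R) a b : a <= b -> (forall x, a <= x <= b -> continuous f x) -> ex_RInt f a b.
Proof.
intros Hab H. apply (@ex_RInt_continuous R_CompleteNormedModule). intros z Hz. apply H.
rewrite Rmin_left in Hz by lra. rewrite Rmax_right in Hz by lra. exact Hz.
Qed.

Lemma RInt_sub_le (f : R -> R) a b c d : a <= b -> b <= c -> c <= d ->
  (forall x, a <= x <= d -> continuous f x) -> (forall x, a <= x <= d -> 0 <= f x) ->
  RInt f b c <= RInt f a d.
Proof.
intros H1 H2 H3 Hc Hp.
assert (E : forall u v, a <= u -> u <= v -> v <= d -> ex_RInt f u v).
{ intros u v Hu Huv Hv. apply ex_RInt_cont; auto. intros; apply Hc; lra. }
rewrite <- (RInt_Chasles_R f a c d), <- (RInt_Chasles_R f a b c) by (apply E; lra).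
assert (0 <= RInt f a b). { apply RInt_ge_0; auto. apply E; lra. intros; apply Hp; lra. }
assert (0 <= RInt f c d). { apply RInt_ge_0; auto. apply E; lra. intros; apply Hp; lra. }
lra.
Qed.

(** Used for a pair of opposite sides. The nonnegative [G] and [H] are integrated over the larger
    interval, so that the bound no longer depends on where the two other sides are placed. *)
Lemma RInt_side (F G H : R -> R) a b a' b' (k m : R) : a' <= a -> a <= b -> b <= b' ->
  0 <= k -> ex_RInt F a b ->
  (forall x, a' <= x <= b' -> continuous G x /\ continuous H x) ->
  (forall x, a' <= x <= b' -> 0 <= G x /\ 0 <= H x) ->
  (forall x, a <= x <= b -> F x <= k * (G x + H x) - m) ->
  RInt F a b <= k * (RInt G a' b' + RInt H a' b') - m * (b - a).
Proof.
intros H1 H2 H3 Hk EF HC HP HF.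
assert (EG : ex_RInt G a b) by (apply ex_RInt_cont; auto; intros; apply HC; lra).
assert (EH : ex_RInt H a b) by (apply ex_RInt_cont; auto; intros; apply HC; lra).
assert (EK : is_RInt (fun x => k * (G x + H x) - m) a b (k * (RInt G a b + RInt H a b) - (b - a) * m)).
{ apply (is_RInt_minus (V := R_NormedModule) (fun x => k * (G x + H x)) (fun _ => m)).
  apply (is_RInt_scal (V := R_NormedModule) (fun x => G x + H x)).
  apply (is_RInt_plus (V := R_NormedModule) G H); apply (RInt_correct (V := R_CompleteNormedModule)); auto.
  apply (is_RInt_const (V := R_NormedModule)). }
eapply Rle_trans. { apply RInt_le with (g := fun x => k * (G x + H x) - m); auto. eexists; exact EK. intros; apply HF; lra. }
rewrite (is_RInt_unique _ _ _ _ EK).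
assert (RInt G a b <= RInt G a' b') by (apply RInt_sub_le; auto; intros; apply HC || apply HP; lra).
assert (RInt H a b <= RInt H a' b') by (apply RInt_sub_le; auto; intros; apply HC || apply HP; lra).
nra.
Qed.

Lemma sum_sq_neq0 s t : s <> 0 -> s * s + t * t <> 0.
Proof. intros Hs. assert (0 < s * s) by (apply Rsqr_pos_lt; auto). assert (0 <= t * t) by apply Rle_0_sqr. lra. Qed.

(** The circulation of e (f(z) - f(c)) / (z - c) around the rectangle vanishes, with c its
    distinguished point and e f(c) = |f(c)|. The part from f(z) is at most (2/r) |f(z)| on the
    sides, since they are at distance at least r/2 from c. The part from f(c) has the same sign on
    all four sides and is bounded away from zero there, so the winding integral of 1/(z - c) need
    not be computed. The sides are left free to move for the later averaging. *)
Lemma Cauchy_estimate_rect f p q r p1 p2 q1 q2 : 0 < r ->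
  p - r <= p1 <= p - r / 2 -> p + r / 2 <= p2 <= p + r ->
  q - r <= q1 <= q - r / 2 -> q + r / 2 <= q2 <= q + r ->
  (forall x y, p - r <= x <= p + r -> q - r <= y <= q + r -> holo_at f (x, y)) ->
  Cmod (f (p, q)) * r / 2 <=
    RInt (fun x => Cmod (f (x, q1))) (p - r) (p + r) + RInt (fun x => Cmod (f (x, q2))) (p - r) (p + r) +
    (RInt (fun y => Cmod (f (p1, y))) (q - r) (q + r) + RInt (fun y => Cmod (f (p2, y))) (q - r) (q + r)).
Proof.
intros Hr Hp1 Hp2 Hq1 Hq2 Hf.
destruct (unimodular_to_Cmod (f (p, q))) as [e [He Hef]].
destruct (loop_slope_zero f e p q p1 p2 q1 q2) as [Hcl H0]; try lra.
{ intros; apply Hf; lra. }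
set (h := fun z => (e * (f z - f (p, q)) * / (z - (p, q)))%C) in *. cbv zeta beta in Hcl, H0.
set (m := Cmod (f (p, q))) in *. assert (Hm : 0 <= m) by apply Cmod_ge_0.
assert (Hdec : forall z, z <> (p, q) -> exists v, h z = (v - m * / (z - (p, q)))%C /\
   (r / 2 <= Cmod (z - (p, q)) -> Cmod v <= 2 / r * Cmod (f z))).
{ intros z Hz. exists (e * f z * / (z - (p, q)))%C. split.
  - unfold h. rewrite <- Hef. ring.
  - intro Hrz. assert (Hz0 : (z - (p, q))%C <> RtoC 0) by (intro K; apply Hz; apply Cminus_eq_0; exact K).
    rewrite !Cmod_mult, Cmod_inv, He, Rmult_1_l, Rmult_comm by auto.
    apply Rmult_le_compat_r; [apply Cmod_ge_0|].
    replace (2 / r) with (/ (r / 2)) by (field; lra). apply Rinv_le_contravar; lra. }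
(* The numerator is at least r/2 and the denominator at most 2 r^2. *)
assert (Hfrac : forall s t, r / 2 <= s <= r -> - r <= t <= r -> / (4 * r) <= s / (s * s + t * t)).
{ intros s t Hs Ht. assert (0 < s * s) by nra. assert (t * t <= r * r) by nra. assert (s * s <= r * r) by nra.
  apply Rmult_le_reg_r with (4 * r * (s * s + t * t)); [nra|].
  replace (/ (4 * r) * (4 * r * (s * s + t * t))) with (s * s + t * t) by (field; lra).
  replace (s / (s * s + t * t) * (4 * r * (s * s + t * t))) with (4 * r * s) by (field; apply Rgt_not_eq; nra). nra. }
assert (Im_bd : forall (v : C), Rabs (Im v) <= Cmod v).
{ intro v. eapply Rle_trans; [apply Rmax_r|apply Rmax_Cmod]. }
set (P := fun x y => Im (h (x, y))) in *. set (Q := fun x y => Re (h (x, y))) in *.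
set (k := 2 / r) in *. set (c0 := m * / (4 * r)).
assert (B1 : forall x, p1 <= x <= p2 -> P x q1 <= k * Cmod (f (x, q1)) - c0).
{ intros x Hx. destruct (Hdec (x, q1)) as [v [Hv Hb]]. { intro K; injection K; intros; lra. }
  assert (Hb' : Cmod v <= k * Cmod (f (x, q1))).
  { apply Hb. eapply Rle_trans; [|apply Cdist_snd]. rewrite Rabs_left; lra. }
  unfold P. rewrite Hv. specialize (Im_bd v). apply Rabs_le_between in Im_bd.
  assert (K := Hfrac (q - q1) (x - p) ltac:(lra) ltac:(lra)).
  assert (K2 := Rmult_le_compat_l m _ _ Hm K). fold c0 in K2.
  assert (E : Im (v - m * / ((x, q1) - (p, q)))%C = Im v - m * ((q - q1) / ((q - q1) * (q - q1) + (x - p) * (x - p)))).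
  { destruct v as [v1 v2]. simpl. unfold Rdiv. field. apply sum_sq_neq0; lra. }
  rewrite E. lra. }
assert (B2 : forall x, p1 <= x <= p2 -> - P x q2 <= k * Cmod (f (x, q2)) - c0).
{ intros x Hx. destruct (Hdec (x, q2)) as [v [Hv Hb]]. { intro K; injection K; intros; lra. }
  assert (Hb' : Cmod v <= k * Cmod (f (x, q2))).
  { apply Hb. eapply Rle_trans; [|apply Cdist_snd]. rewrite Rabs_pos_eq; lra. }
  unfold P. rewrite Hv. specialize (Im_bd v). apply Rabs_le_between in Im_bd.
  assert (K := Hfrac (q2 - q) (x - p) ltac:(lra) ltac:(lra)).
  assert (K2 := Rmult_le_compat_l m _ _ Hm K). fold c0 in K2.
  assert (E : Im (v - m * / ((x, q2) - (p, q)))%C = Im v + m * ((q2 - q) / ((q2 - q) * (q2 - q) + (x - p) * (x - p)))).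
  { destruct v as [v1 v2]. simpl. unfold Rdiv. field. apply sum_sq_neq0; lra. }
  rewrite E. lra. }
assert (B3 : forall y, q1 <= y <= q2 -> Q p2 y <= k * Cmod (f (p2, y)) - c0).
{ intros y Hy. destruct (Hdec (p2, y)) as [v [Hv Hb]]. { intro K; injection K; intros; lra. }
  assert (Hb' : Cmod v <= k * Cmod (f (p2, y))).
  { apply Hb. eapply Rle_trans; [|apply Cdist_fst]. rewrite Rabs_pos_eq; lra. }
  unfold Q. rewrite Hv. assert (R_bd := re_le_Cmod v). apply Rabs_le_between in R_bd.
  assert (K := Hfrac (p2 - p) (y - q) ltac:(lra) ltac:(lra)).
  assert (K2 := Rmult_le_compat_l m _ _ Hm K). fold c0 in K2.
  assert (E : Re (v - m * / ((p2, y) - (p, q)))%C = Re v - m * ((p2 - p) / ((p2 - p) * (p2 - p) + (y - q) * (y - q)))).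
  { destruct v as [v1 v2]. simpl. unfold Rdiv. field. apply sum_sq_neq0; lra. }
  rewrite E. lra. }
assert (B4 : forall y, q1 <= y <= q2 -> - Q p1 y <= k * Cmod (f (p1, y)) - c0).
{ intros y Hy. destruct (Hdec (p1, y)) as [v [Hv Hb]]. { intro K; injection K; intros; lra. }
  assert (Hb' : Cmod v <= k * Cmod (f (p1, y))).
  { apply Hb. eapply Rle_trans; [|apply Cdist_fst]. rewrite Rabs_left; lra. }
  unfold Q. rewrite Hv. assert (R_bd := re_le_Cmod v). apply Rabs_le_between in R_bd.
  assert (K := Hfrac (p - p1) (y - q) ltac:(lra) ltac:(lra)).
  assert (K2 := Rmult_le_compat_l m _ _ Hm K). fold c0 in K2.
  assert (E : Re (v - m * / ((p1, y) - (p, q)))%C = Re v + m * ((p - p1) / ((p - p1) * (p - p1) + (y - q) * (y - q)))).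
  { destruct v as [v1 v2]. simpl. unfold Rdiv. field. apply sum_sq_neq0; lra. }
  rewrite E. lra. }
assert (Hk : 0 < k) by (unfold k; apply Rdiv_lt_0_compat; lra).
assert (I1 : RInt (fun x => P x q1 - P x q2) p1 p2 <= k * (RInt (fun x => Cmod (f (x, q1))) (p - r) (p + r) + RInt (fun x => Cmod (f (x, q2))) (p - r) (p + r)) - 2 * c0 * (p2 - p1)).
{ apply RInt_side; try lra.
  - apply ex_RInt_minus_R; apply closed_at_ex_RInt1 with Q; try lra; intros; apply Hcl; lra.
  - intros; split; apply holo_at_continuous_x, Hf; lra.
  - intros; split; apply Cmod_ge_0.
  - intros x Hx. specialize (B1 x Hx). specialize (B2 x Hx). lra. }
assert (I2 : RInt (fun y => Q p2 y - Q p1 y) q1 q2 <= k * (RInt (fun y => Cmod (f (p1, y))) (q - r) (q + r) + RInt (fun y => Cmod (f (p2, y))) (q - r) (q + r)) - 2 * c0 * (q2 - q1)).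
{ apply RInt_side; try lra.
  - apply ex_RInt_minus_R; apply closed_at_ex_RInt2 with P; try lra; intros; apply Hcl; lra.
  - intros; split; apply holo_at_continuous_y, Hf; lra.
  - intros; split; apply Cmod_ge_0.
  - intros x Hx. specialize (B3 x Hx). specialize (B4 x Hx). lra. }
change (RInt (fun x => P x q1 - P x q2) p1 p2 + RInt (fun y => Q p2 y - Q p1 y) q1 q2 = 0) in H0.
set (S1 := RInt (fun x => Cmod (f (x, q1))) _ _ + _) in *. set (S2 := RInt (fun y => Cmod (f (p1, y))) _ _ + _) in *.
assert (Hc0 : 0 <= c0) by (unfold c0; apply Rle_mult_inv_pos; lra).
(* Each side has length at least r, so the term from f(c) contributes at least 2 c0 (2 r) =
   |f(c)|. *)
assert (T0 : 0 <= c0 * ((p2 - p1) + (q2 - q1) - 2 * r)) by (apply Rmult_le_pos; lra).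
assert (T : 2 * c0 * (2 * r) <= k * (S1 + S2)) by lra.
apply Rmult_le_reg_l with k; auto.
replace (k * (m * r / 2)) with m by (unfold k; field; lra).
replace (2 * c0 * (2 * r)) with m in T by (unfold c0; field; lra). lra.
Qed.

(** A maximum principle with constant 16: four sides of length 2 r, multiplied by 2 / r. The loss is
    harmless for a boundary bound that can be made arbitrarily small. *)
Lemma Cauchy_estimate_sup f p q r M : 0 < r ->
  (forall x y, p - r <= x <= p + r -> q - r <= y <= q + r -> holo_at f (x, y)) ->
  (forall x y, p - r <= x <= p + r -> q - r <= y <= q + r ->
     Rabs (x - p) = r \/ Rabs (y - q) = r -> Cmod (f (x, y)) <= M) ->
  Cmod (f (p, q)) <= 16 * M.
Proof.
intros Hr Hf HM.
assert (K := Cauchy_estimate_rect f p q r (p - r) (p + r) (q - r) (q + r) Hr ltac:(lra) ltac:(lra) ltac:(lra) ltac:(lra) Hf).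
assert (B : forall g c, (forall t, c - r <= t <= c + r -> continuous g t) -> (forall t, c - r <= t <= c + r -> g t <= M) ->
  RInt g (c - r) (c + r) <= 2 * r * M).
{ intros g c Hg Hgm. replace (2 * r * M) with (RInt (fun _ => M) (c - r) (c + r)).
  2:{ rewrite RInt_const. unfold scal; simpl; unfold mult; simpl. ring. }
  apply RInt_le; try lra. apply ex_RInt_cont; auto; lra. apply ex_RInt_const. intros; apply Hgm; lra. }
assert (L : p + r - p = r /\ q + r - q = r /\ p - r - p = - r /\ q - r - q = - r) by (repeat split; ring).
destruct L as [L1 [L2 [L3 L4]]].
assert (A : Rabs r = r) by (apply Rabs_pos_eq; lra).
assert (J1 := B (fun x => Cmod (f (x, q - r))) p). assert (J2 := B (fun x => Cmod (f (x, q + r))) p).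
assert (J3 := B (fun y => Cmod (f (p - r, y))) q). assert (J4 := B (fun y => Cmod (f (p + r, y))) q).
cbv beta in J1, J2, J3, J4.
assert (Cmod (f (p, q)) * r / 2 <= 8 * r * M).
{ eapply Rle_trans; [exact K|].
  replace (8 * r * M) with (2 * r * M + 2 * r * M + (2 * r * M + 2 * r * M)) by ring.
  repeat apply Rplus_le_compat; [apply J1|apply J2|apply J3|apply J4]; intros t Ht;
   try (apply holo_at_continuous_x, Hf; lra); try (apply holo_at_continuous_y, Hf; lra); apply HM; try lra.
  - right. rewrite L4, Rabs_Ropp; auto.
  - right. rewrite L2; auto.
  - left. rewrite L3, Rabs_Ropp; auto.
  - left. rewrite L1; auto. }
apply Rmult_le_reg_r with (r / 2); lra.
Qed.

Lemma holo_holo_at f : holo f -> forall x y, 0 < y -> holo_at f (x, y).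
Proof. intros H x y Hy. destruct (H (x, y) Hy) as [l Hl]. exists l. apply cderiv_is_derive; exact Hl. Qed.

Lemma holo_at_holo f : (forall x y, 0 < y -> holo_at f (x, y)) -> holo f.
Proof. intros H [x y] Hz. destruct (H x y Hz) as [l Hl]. exists l. apply cderiv_is_derive; exact Hl. Qed.

Lemma holo_at_mult f g z : holo_at f z -> holo_at g z -> holo_at (fun w => (f w * g w)%C) z.
Proof. intros [l Hl] [m Hm]. eexists. apply cderiv_mult; eauto. Qed.

Lemma holo_mult f g : holo f -> holo g -> holo (fun w => (f w * g w)%C).
Proof. intros Hf Hg. apply holo_at_holo. intros x y Hy. apply holo_at_mult; apply holo_holo_at; auto. Qed.

(* The product of g with its rotations by quarter turns about the centre of a square is small on
   the whole boundary of the square as soon as g is small on one side. *)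
Lemma holo_zero_of_small_side g p q M : 0 < q -> holo g ->
  (forall x y, 0 < y <= 2 * q -> Cmod (g (x, y)) <= M) ->
  (forall eps, 0 < eps -> exists del, 0 < del /\ forall x y, 0 < y < del -> Cmod (g (x, y)) <= eps) ->
  g (p, q) = RtoC 0.
Proof.
intros Hq Hg HM Hs.
assert (HM0 : 0 <= M). { eapply Rle_trans; [apply Cmod_ge_0|apply (HM p q); lra]. }
set (c := (p, q) : C).
set (rot := fun (k : C) (z : C) => (k * z + (c - k * c))%C).
set (F := fun z => (g (rot 1 z) * g (rot Ci z) * (g (rot (-(1)) z) * g (rot (- Ci) z)))%C).
assert (R1 : forall x y, rot 1%C (x, y) = (x, y)). { intros; unfold rot, c. apply injective_projections; simpl; ring. }
assert (R2 : forall x y, rot Ci (x, y) = (p - (y - q), q + (x - p))). { intros; unfold rot, c. apply injective_projections; simpl; ring. }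
assert (R3 : forall x y, rot (- (1))%C (x, y) = (p - (x - p), q - (y - q))). { intros; unfold rot, c. apply injective_projections; simpl; ring. }
assert (R4 : forall x y, rot (- Ci)%C (x, y) = (p + (y - q), q - (x - p))). { intros; unfold rot, c. apply injective_projections; simpl; ring. }
assert (Fc : F c = (g c * g c * (g c * g c))%C).
{ unfold F, c. rewrite R1, R2, R3, R4. replace (q + (p - p)) with q by ring. replace (q - (p - p)) with q by ring.
  replace (q - (q - q)) with q by ring. replace (p - (q - q)) with p by ring. replace (p + (q - q)) with p by ring.
  replace (p - (p - p)) with p by ring. reflexivity. }
assert (Bd : forall eps, 0 < eps -> Cmod (g c) ^ 4 <= 16 * (eps * M ^ 3)).
{ intros eps Heps. destruct (Hs eps Heps) as [del [Hdel Hsm]].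
  (* The square of half-side q - eta around (p, q) stays in the half-plane, and its lower side lies
     at height eta < del, where g is at most [eps]. *)
  set (eta := Rmin (del / 2) (q / 2)).
  assert (He : 0 < eta) by (apply Rmin_pos; lra).
  assert (He1 : eta <= del / 2) by apply Rmin_l. assert (He2 : eta <= q / 2) by apply Rmin_r.
  replace (Cmod (g c) ^ 4) with (Cmod (F c)). 2:{ rewrite Fc, !Cmod_mult. ring. }
  apply (Cauchy_estimate_sup F p q (q - eta)); try lra.
  - intros x y Hx Hy. unfold F.
    assert (D : forall k, 0 < snd (rot k (x, y)) -> holo_at (fun z => g (rot k z)) (x, y)).
    { intros k Hk. destruct (rot k (x, y)) as [u v] eqn:E. destruct (holo_holo_at g Hg u v Hk) as [l Hl].
      rewrite <- E in Hl. eexists. apply cderiv_comp; [exact Hl|apply cderiv_affine]. }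
    apply holo_at_mult; apply holo_at_mult; apply D; rewrite ?R1, ?R2, ?R3, ?R4; simpl; lra.
  - intros x y Hx Hy Hb. unfold F. rewrite !Cmod_mult, R1, R2, R3, R4.
    assert (G1 : Cmod (g (x, y)) <= M) by (apply HM; lra).
    assert (G2 : Cmod (g (p - (y - q), q + (x - p))) <= M) by (apply HM; lra).
    assert (G3 : Cmod (g (p - (x - p), q - (y - q))) <= M) by (apply HM; lra).
    assert (G4 : Cmod (g (p + (y - q), q - (x - p))) <= M) by (apply HM; lra).
    assert (Sm : Cmod (g (x, y)) <= eps \/ Cmod (g (p - (y - q), q + (x - p))) <= eps \/
       Cmod (g (p - (x - p), q - (y - q))) <= eps \/ Cmod (g (p + (y - q), q - (x - p))) <= eps).
    { destruct Hb as [Hb|Hb]; [destruct (Rcase_abs (x - p)) as [L|L]|destruct (Rcase_abs (y - q)) as [L|L]].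
      - rewrite Rabs_left in Hb by lra. right; left. apply Hsm; lra.
      - rewrite Rabs_right in Hb by lra. right; right; right. apply Hsm; lra.
      - rewrite Rabs_left in Hb by lra. left. apply Hsm; lra.
      - rewrite Rabs_right in Hb by lra. right; right; left. apply Hsm; lra. }
    set (a1 := Cmod (g (x, y))) in *. set (a2 := Cmod (g (p - _, _))) in *. set (a3 := Cmod (g (_, q - (y - q)))) in *.
    set (a4 := Cmod (g (p + _, _))) in *.
    assert (N1 : 0 <= a1) by apply Cmod_ge_0. assert (N2 : 0 <= a2) by apply Cmod_ge_0.
    assert (N3 : 0 <= a3) by apply Cmod_ge_0. assert (N4 : 0 <= a4) by apply Cmod_ge_0.
    assert (P4 : forall b1 b2 b3 b4, 0 <= b1 <= eps -> 0 <= b2 <= M -> 0 <= b3 <= M -> 0 <= b4 <= M ->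
       b1 * b2 * (b3 * b4) <= eps * M ^ 3).
    { intros. replace (eps * M ^ 3) with (eps * M * (M * M)) by ring.
      apply Rmult_le_compat; try (apply Rmult_le_pos; lra); apply Rmult_le_compat; lra. }
    destruct Sm as [S|[S|[S|S]]].
    + apply P4; lra.
    + replace (a1 * a2 * (a3 * a4)) with (a2 * a1 * (a3 * a4)) by ring. apply P4; lra.
    + replace (a1 * a2 * (a3 * a4)) with (a3 * a1 * (a2 * a4)) by ring. apply P4; lra.
    + replace (a1 * a2 * (a3 * a4)) with (a4 * a1 * (a2 * a3)) by ring. apply P4; lra. }
destruct (Req_dec (Cmod (g c)) 0) as [E|E]; [apply Cmod_eq_0; exact E|exfalso].
assert (Hpos : 0 < Cmod (g c)) by (assert (K := Cmod_ge_0 (g c)); lra).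
assert (H4 : 0 < Cmod (g c) ^ 4) by (apply pow_lt; auto). set (A := Cmod (g c) ^ 4) in *.
assert (HM3 : 0 <= M ^ 3) by (apply pow_le; auto).
specialize (Bd (A / (16 * M ^ 3 + 1)) ltac:(apply Rdiv_lt_0_compat; lra)).
assert (E2 : 16 * (A / (16 * M ^ 3 + 1) * M ^ 3) = A - A / (16 * M ^ 3 + 1)) by (field; lra).
assert (0 < A / (16 * M ^ 3 + 1)) by (apply Rdiv_lt_0_compat; lra). lra.
Qed.

(** * Growth functions *)

Lemma inU_growth Phi : inU Phi -> growth Phi.
Proof. intros [q [_ [H _]]]; exact H. Qed.

Lemma growth_0 Phi : growth Phi -> Phi 0 = 0.
Proof.
intros [_ [Hm [Hp Ho]]]. destruct (Ho 0 (Rle_refl _)) as [t [Ht E]].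
assert (K := Hm 0 t (Rle_refl _) Ht). assert (K' := Hp 0 (Rle_refl _)). lra.
Qed.

(** A zero of Phi at t > 0 would propagate to every s >= t by the upper type condition, so Phi would
    not reach the value 1. *)
Lemma inU_pos Phi t : inU Phi -> 0 < t -> 0 < Phi t.
Proof.
intros [q [_ [[_ [Hm [Hp Ho]]] [[C [HC Hu]] _]]]] Ht.
destruct (Rle_lt_or_eq_dec 0 (Phi t) (Hp t ltac:(lra))) as [|E]; auto. exfalso.
destruct (Ho 1 ltac:(lra)) as [s [Hs Es]].
destruct (Rle_dec s t) as [L|L].
- assert (K := Hm s t Hs L). lra.
- assert (Hst : 1 <= s / t).
  { apply Rmult_le_reg_r with t; auto. unfold Rdiv. rewrite Rmult_assoc, Rinv_l; lra. }
  assert (K := Hu t (s / t) Ht Hst). replace (t * (s / t)) with s in K by (field; lra).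
  rewrite <- E, Rmult_0_r in K. lra.
Qed.

(** The monotonicity of Phi(t)/t in the form that stands in for convexity from here on. *)
Lemma inU_scale Phi a s : inU Phi -> 0 <= a <= 1 -> 0 <= s -> Phi (a * s) <= a * Phi s.
Proof.
intros HU Ha Hs. assert (Hz := growth_0 _ (inU_growth _ HU)).
assert (Hp : 0 <= Phi s) by (apply (inU_growth _ HU); auto).
destruct (Req_dec (a * s) 0) as [E|E]. { rewrite E, Hz. apply Rmult_le_pos; lra. }
assert (Has : 0 < a /\ 0 < s) by (destruct Ha as [[?| <-] ?], Hs as [?| <-]; lra).
destruct HU as [q [_ [_ [_ Hd]]]].
assert (K := Hd (a * s) s ltac:(nra) ltac:(nra)).
apply Rmult_le_reg_r with (/ (a * s)). apply Rinv_0_lt_compat; nra.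
replace (a * Phi s * / (a * s)) with (Phi s / s) by (field; lra). exact K.
Qed.

Lemma inU_strict Phi s t : inU Phi -> 0 <= s < t -> Phi s < Phi t.
Proof.
intros HU Hst. assert (Ht := inU_pos Phi t HU ltac:(lra)).
assert (H1 : s / t < 1). { apply Rmult_lt_reg_r with t; [lra|]. unfold Rdiv. rewrite Rmult_assoc, Rinv_l; lra. }
assert (H0 : 0 <= s / t) by (apply Rle_mult_inv_pos; lra).
assert (K := inU_scale Phi (s / t) t HU ltac:(lra) ltac:(lra)).
replace (s / t * t) with s in K by (field; lra). nra.
Qed.

Lemma inU_le_inv Phi s t : inU Phi -> 0 <= s -> 0 <= t -> Phi s <= Phi t -> s <= t.
Proof.
intros HU Hs Ht H. destruct (Rle_dec s t) as [|L]; auto. assert (K := inU_strict Phi t s HU). lra.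
Qed.

(* Replaces Jensen's inequality. *)
Lemma inU_young Phi m u : inU Phi -> 0 < m -> 0 <= u -> u <= m + m / Phi m * Phi u.
Proof.
intros HU Hm Hu. assert (Pm := inU_pos Phi m HU Hm).
assert (Pu : 0 <= Phi u) by (apply (inU_growth _ HU); auto).
assert (0 < m / Phi m) by (apply Rdiv_lt_0_compat; auto).
destruct (Rle_dec u m) as [L|L]. { assert (0 <= m / Phi m * Phi u) by (apply Rmult_le_pos; lra). lra. }
assert (H0 : 0 <= m / u <= 1).
{ split; [apply Rle_mult_inv_pos; lra|]. apply Rmult_le_reg_r with u; [lra|]. unfold Rdiv. rewrite Rmult_assoc, Rinv_l; lra. }
assert (K := inU_scale Phi (m / u) u HU H0 Hu).
replace (m / u * u) with m in K by (field; lra).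
assert (u <= m / Phi m * Phi u); [|lra].
apply Rmult_le_reg_l with (m / u * Phi m). { apply Rmult_lt_0_compat; auto. apply Rdiv_lt_0_compat; lra. }
replace (m / u * Phi m * u) with (m * Phi m) by (field; lra).
replace (m / u * Phi m * (m / Phi m * Phi u)) with (m * (m / u * Phi u)) by (field; lra).
apply Rmult_le_compat_l; lra.
Qed.

Lemma inU_dilate Phi T : inU Phi -> 1 <= T -> exists K, 0 < K /\ forall s, 0 <= s -> Phi (s * T) <= K * Phi s.
Proof.
intros HU HT. assert (HU' := HU). destruct HU' as [q [_ [_ [[C [HC Hu]] _]]]].
exists (C * Rpower T q). split. { apply Rmult_lt_0_compat; auto. apply exp_pos. }
intros s [Hs| <-]. auto. rewrite Rmult_0_l, growth_0 by (apply inU_growth; auto). lra.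
Qed.

Lemma inUtilde_inU Phi : inUtilde Phi -> inU Phi.
Proof. intros [q [Hq [H _]]]. exists q; auto. Qed.

(* Taking a = b, respectively a = 1, in the second condition of the class bounds Phi below at
   infinity, respectively above at 0, by the power t^q, matching the upper type of Phi. *)
Lemma inUtilde_power Phi : inUtilde Phi -> exists q k K, 1 <= q /\ 0 < k /\ 0 < K /\
  forall t, 0 < t -> k * Rpower t q <= Phi t <= K * Rpower t q.
Proof.
intros HU. assert (P1 := inU_pos Phi 1 (inUtilde_inU _ HU) Rlt_0_1).
destruct HU as [q [Hq [[_ [[C [HC Hu]] _]] [C1 [C2 [C3 [H1 [H2 [H3 [_ [Hb _]]]]]]]]]]].
assert (Rinv_pow : forall t, 0 < t -> Rpower (/ t) q = / Rpower t q).
{ intros t Ht. unfold Rpower. rewrite ln_Rinv by auto. rewrite <- exp_Ropp. f_equal. ring. }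
(* For t >= 1 the lower bound comes from the second condition and the upper bound from the upper
   type; for t < 1 the two exchange roles. *)
set (k := Rmin (Phi 1 / C2) (Phi 1 / C)). set (K := Rmax (C * Phi 1) (C2 * Phi 1)).
assert (K1 : k <= Phi 1 / C2) by apply Rmin_l. assert (K2 : k <= Phi 1 / C) by apply Rmin_r.
assert (K3 : C * Phi 1 <= K) by apply Rmax_l. assert (K4 : C2 * Phi 1 <= K) by apply Rmax_r.
exists q, k, K. repeat split; auto.
{ apply Rmin_pos; apply Rdiv_lt_0_compat; auto. }
{ eapply Rlt_le_trans; [|apply K3]. apply Rmult_lt_0_compat; auto. }
{ assert (Pt : 0 < Rpower t q) by apply exp_pos. destruct (Rle_dec 1 t) as [L|L].
  - assert (E := Hb t t L L). replace (t / t) with 1 in E by (field; lra).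
    apply Rle_trans with (Phi 1 / C2 * Rpower t q). { apply Rmult_le_compat_r; lra. }
    apply Rmult_le_reg_r with (C2 * / Rpower t q). { apply Rmult_lt_0_compat; auto. apply Rinv_0_lt_compat; auto. }
    replace (Phi 1 / C2 * Rpower t q * (C2 * / Rpower t q)) with (Phi 1) by (field; lra).
    eapply Rle_trans; [exact E|]. right. unfold Rdiv. ring.
  - assert (L' : 1 <= / t) by (rewrite <- Rinv_1; apply Rinv_le_contravar; lra).
    assert (E := Hu t (/ t) H L'). rewrite Rinv_r, Rinv_pow in E by lra.
    apply Rle_trans with (Phi 1 / C * Rpower t q). { apply Rmult_le_compat_r; lra. }
    apply Rmult_le_reg_r with (C * / Rpower t q). { apply Rmult_lt_0_compat; auto. apply Rinv_0_lt_compat; auto. }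
    replace (Phi 1 / C * Rpower t q * (C * / Rpower t q)) with (Phi 1) by (field; lra). lra. }
{ assert (Pt : 0 < Rpower t q) by apply exp_pos. destruct (Rle_dec 1 t) as [L|L].
  - assert (E := Hu 1 t Rlt_0_1 L). rewrite Rmult_1_l in E. eapply Rle_trans; [exact E|].
    replace (C * Rpower t q * Phi 1) with (C * Phi 1 * Rpower t q) by ring. apply Rmult_le_compat_r; lra.
  - assert (L' : 1 <= / t) by (rewrite <- Rinv_1; apply Rinv_le_contravar; lra).
    assert (E := Hb 1 (/ t) (Rle_refl _) L'). rewrite Rinv_pow in E by auto.
    unfold Rdiv in E. rewrite !Rinv_inv, Rmult_1_l in E. eapply Rle_trans; [exact E|]. apply Rmult_le_compat_r; lra. }
Qed.

Lemma Rpower_base_le D q : 1 <= D -> 1 <= q -> D <= Rpower D q.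
Proof.
intros HD Hq. rewrite <- (Rpower_1 D) at 1 by lra. apply Rle_Rpower; lra.
Qed.

Lemma Rpower_pos x y : 0 < Rpower x y.
Proof. apply exp_pos. Qed.

(* A = Phi1^-1(Y1) and B = Phi2^-1(Y2): the product of a value u <= A with a multiplier w <= B / A,
   compared with Phi1 u. *)
Lemma multiplier_pointwise Phi1 Phi2 : inU Phi1 -> inUtilde Phi2 ->
  (forall s t, 0 < s -> s <= t -> Phi2 s / Phi1 s <= Phi2 t / Phi1 t) ->
  exists D, 1 <= D /\ forall A B u w, 0 < A -> 0 < B -> 0 <= u <= A -> 0 <= w <= B / A ->
    Phi2 (u * w / D) <= Phi1 u * (Phi2 B / Phi1 A).
Proof.
intros HU1 HT HR. assert (HU2 := inUtilde_inU _ HT).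
destruct (inUtilde_power _ HT) as [q [k [K [Hq [Hk [HK Hp]]]]]].
(* A factor K / k is lost twice, once in comparing Phi2 at u w / D and at B with powers, once at u
   and A. Since D >= 1 and q >= 1, D^q >= D absorbs both. *)
set (D := Rmax 1 (K * K / (k * k))). assert (D1 : 1 <= D) by apply Rmax_l.
assert (D2 : K * K / (k * k) <= D) by apply Rmax_r.
exists D. split; auto. intros A B u w HA HB Hu Hw.
assert (PA := inU_pos _ A HU1 HA). assert (PB := inU_pos _ B HU2 HB).
destruct (Req_dec (u * w) 0) as [E|E].
{ rewrite E. unfold Rdiv at 1. rewrite Rmult_0_l, growth_0 by (apply inU_growth; auto).
  apply Rmult_le_pos. apply (inU_growth _ HU1); lra. apply Rle_mult_inv_pos; lra. }
assert (Huw : 0 < u /\ 0 < w) by (destruct Hu as [[?| <-] ?], Hw as [[?| <-] ?]; lra).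
destruct Huw as [Hu0 Hw0]. assert (Pu := inU_pos _ u HU1 Hu0).
set (a := Rpower u q). set (b := Rpower w q). set (g := Rpower A q). set (h := Rpower B q). set (d := Rpower D q).
assert (a0 : 0 < a) by apply exp_pos. assert (b0 : 0 < b) by apply exp_pos. assert (g0 : 0 < g) by apply exp_pos.
assert (h0 : 0 < h) by apply exp_pos. assert (d0 : 0 < d) by apply exp_pos.
assert (Hd : K * K / (k * k) <= d) by (eapply Rle_trans; [exact D2|apply Rpower_base_le; auto]).
assert (Hbgh : b * g <= h).
{ unfold b, g, h. rewrite Rpower_mult_distr by auto. apply Rle_Rpower_l; [lra|]. split. apply Rmult_lt_0_compat; auto.
  apply Rmult_le_reg_r with (/ A). apply Rinv_0_lt_compat; auto. rewrite Rmult_assoc, Rinv_r by lra. lra. }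
assert (E1 : Phi2 (u * w / D) <= K * (a * b * / d)).
{ eapply Rle_trans. apply Hp. apply Rdiv_lt_0_compat; nra. right; f_equal.
  unfold a, b, d. unfold Rdiv. rewrite <- !Rpower_mult_distr; auto; try (apply Rinv_0_lt_compat; lra); try nra.
  f_equal. unfold Rpower. rewrite ln_Rinv by lra. rewrite <- exp_Ropp. f_equal. ring. }
assert (E2 : k * a <= Phi2 u) by (apply Hp; auto).
assert (E3 : Phi2 u <= Phi1 u * (Phi2 A / Phi1 A)).
{ assert (R := HR u A Hu0 (proj2 Hu)). apply Rmult_le_reg_r with (/ Phi1 u). apply Rinv_0_lt_compat; auto.
  replace (Phi1 u * (Phi2 A / Phi1 A) * / Phi1 u) with (Phi2 A / Phi1 A) by (field; lra). exact R. }
assert (E4 : Phi2 A <= K * g) by (apply Hp; auto).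
assert (E5 : k * h <= Phi2 B) by (apply Hp; auto).
assert (Hd' : K * K * / d <= k * k).
{ apply Rmult_le_reg_r with d; auto. rewrite Rmult_assoc, Rinv_l by lra.
  apply Rmult_le_reg_r with (/ (k * k)). apply Rinv_0_lt_compat; nra.
  replace (k * k * d * / (k * k)) with d by (field; lra). lra. }
(* The monotone ratio reads Phi2(u) <= x Phi2(A); in powers, u^q <= (K / k) x A^q. Together with (w
   A)^q <= B^q this bounds (u w)^q by a multiple of x B^q. *)
set (x := Phi1 u / Phi1 A). assert (x0 : 0 < x) by (apply Rdiv_lt_0_compat; auto).
assert (E6 : k * a <= x * (K * g)).
{ eapply Rle_trans; [exact E2|]. eapply Rle_trans; [exact E3|].
  replace (Phi1 u * (Phi2 A / Phi1 A)) with (x * Phi2 A) by (unfold x; field; lra). apply Rmult_le_compat_l; lra. }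
replace (Phi1 u * (Phi2 B / Phi1 A)) with (x * Phi2 B) by (unfold x; field; lra).
eapply Rle_trans; [exact E1|]. apply Rle_trans with (x * (k * h)). 2:{ apply Rmult_le_compat_l; lra. }
apply Rmult_le_reg_l with k; auto.
apply Rle_trans with (x * (K * K * / d) * (b * g)).
{ replace (k * (K * (a * b * / d))) with ((k * a) * (K * (b * / d))) by ring.
  replace (x * (K * K * / d) * (b * g)) with ((x * (K * g)) * (K * (b * / d))) by ring.
  apply Rmult_le_compat_r; auto. repeat apply Rmult_le_pos; try lra. left; apply Rinv_0_lt_compat; auto. }
replace (k * (x * (k * h))) with (x * (k * k) * h) by ring.
apply Rmult_le_compat; try nra. apply Rmult_le_pos; [lra|]. apply Rmult_le_pos; [nra|]. left; apply Rinv_0_lt_compat; auto.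
Qed.

From mathcomp Require Import all_boot all_order all_algebra.
From mathcomp Require Import all_classical all_reals all_analysis Rstruct Rstruct_topology.
From mathcomp Require Import measurable_realfun.
Import Order.TTheory GRing.Theory Num.Theory numFieldNormedType.Exports.

Local Open Scope classical_set_scope.
Local Open Scope R_scope.

(** * Riemann and Lebesgue integrals *)

Local Notation leb := (@lebesgue_measure R).

Lemma derivable_pt_lim_cvg (F : R -> R) (x l : R) : derivable_pt_lim F x l ->
  ((fun h : R => (h^-1 *: ((F : R^o -> R^o) (h *: (1:R^o) + x) - F x))%R) h @[h --> (0:R)^'] --> (l:R^o)).
Proof.
  move=> H.
  apply/cvgrPdist_lt => e /RltP e0.
  have [d Hd] := H e e0.
  have d0 : (0 < (d : R))%R by apply/RltP; apply: cond_pos.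
  near=> h.
  have h0 : h <> 0 by apply/eqP; near: h; exact: nbhs_dnbhs_neq.
  have hd : Rabs h < d.
    apply/RltP. rewrite RabsE. near: h. exact: (@dnbhs0_lt R R^o).
  apply/RltP; rewrite -RabsE; move: (Hd h h0 hd); rewrite -Rabs_Ropp; congr (Rlt (Rabs _) _).
  rewrite /GRing.scale /= (_ : (h * 1 + x)%R = x + h); last by rewrite mulr1 addrC.
  change (- ((F (x + h) - F x) / h - l) = l - / h * (F (x + h) - F x)); rewrite /Rdiv; ring.
Unshelve. all: by end_near.
Qed.

Lemma derivable_pt_lim_is_derive (F : R -> R) (x l : R) :
  derivable_pt_lim F x l -> is_derive (x : R^o) (1 : R^o) (F : R^o -> R^o) l.
Proof.
move=> /derivable_pt_lim_cvg cv.
have dF : derivable (F : R^o -> R^o) x 1 by apply/cvg_ex; exists l.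
apply: (DeriveDef dF).
by apply/cvg_lim => //.
Qed.

Lemma Coquelicot_continuous_continuous (f : R -> R) (x : R) :
  Continuity.continuous f x -> {for x, continuous f}.
Proof. by move=> H; apply/continuity_pt_cvg; apply/continuity_pt_filterlim. Qed.

Lemma integral_RInt (f : R -> R) (a b : R) : a < b ->
  (forall x, a <= x <= b -> Continuity.continuous f x) ->
  (\int[leb]_(x in `[a, b]) (f x)%:E = (RInt f a b)%:E)%E.
Proof.
move=> ab cf.
(* Clamping the argument to [a, b] gives a continuous function on the whole line, whose primitive is
   differentiable at the endpoints too. *)
pose cl x := Rmax a (Rmin x b).
have clP x : a <= cl x <= b by rewrite /cl; split; [apply: Rmax_l|apply: Rmax_lub; [lra|apply: Rmin_r]].
have clE x : a <= x <= b -> cl x = x by move=> [? ?]; rewrite /cl Rmin_left ?Rmax_right.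
have clc x : Continuity.continuous cl x.
  apply/continuity_pt_filterlim => e e0; exists e; split => // y [_ Hy].
  move: Hy; rewrite /= /Rdist => Hy; apply: Rle_lt_trans Hy.
  rewrite /cl /Rmin; repeat case: Rle_dec => ?; rewrite /Rmax; repeat case: Rle_dec => ?; rewrite /Rabs; repeat case: Rcase_abs => ?; lra.
pose g x := f (cl x).
have cg x : Continuity.continuous g x.
  by apply: Continuity.continuous_comp; [apply: clc|apply: cf; apply: clP].
pose G x := RInt g a x.
have dG x : derivable_pt_lim G x (g x).
  apply/is_derive_Reals; apply: (@RInt_analysis.is_derive_RInt _ g G a) => //.
  apply: Hierarchy.filter_forall => y; apply: (RInt_correct (V:=R_CompleteNormedModule)).
  by apply: (@ex_RInt_continuous R_CompleteNormedModule) => z _; apply: cg.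
have iG x := derivable_pt_lim_is_derive G x (g x) (dG x).
transitivity (\int[leb]_(x in `[a, b]) (g x)%:E)%E.
  apply: eq_integral => x; rewrite inE /= in_itv /= => /andP[/RleP ? /RleP ?].
  by rewrite /g clE.
rewrite (@continuous_FTC2 _ g G).
- rewrite -EFinB; congr (EFin _); rewrite /G.
  rewrite RInt_point. rewrite subr0.
  apply: RInt_ext => x. rewrite Rmin_left ?Rmax_right; [|lra|lra] => -[? ?]. by rewrite /g clE //; lra.
- exact/RltP.
- apply: continuous_subspaceT => x; exact: Coquelicot_continuous_continuous.
- have cG x : {for x, continuous G}.
    apply/continuity_pt_cvg; apply: derivable_continuous_pt.
    by exists (g x); exact: dG.
  split.
  + by move=> x _; have [] := iG x.
  + by apply: cvg_at_right_filter; exact: cG.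
  + by apply: cvg_at_left_filter; exact: cG.
- move=> x _; rewrite derive1E; have H := iG x. exact: derive_val.
Qed.

(** * Borel measurability in the plane *)

Local Notation MR := (g_sigma_algebraType (R.-ocitv.-measurable)).
Local Notation MR2 := (MR * MR)%type.
Local Notation leb2 := (@lebesgue_measure R \x @lebesgue_measure R)%E.

(** Openness for the maximum norm, stated with the two coordinates, which is the form of the
    continuity estimates for [Cmod (f z)]. *)
Definition box_open (O : set MR2) := forall x y, O (x, y) -> exists d, 0 < d /\
  forall u v, Rabs (u - x) < d -> Rabs (v - y) < d -> O (u, v).

Lemma Rabs_lt_itv {x d a b u : R} : x - d < a -> b < x + d -> a < u -> u < b -> Rabs (u - x) < d.
Proof. by move=> *; apply: Rabs_def1; lra. Qed.

Lemma Rabs_lt_minus_gt (p q a : R) : Rabs (p - q) < q - a -> a < p.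
Proof. by move=> /Rabs_def2; lra. Qed.

(** An open set is the union of the open rational rectangles that it contains. The union is indexed
    by all rational quadruples, those of rectangles not contained in O giving the empty set. *)
Lemma box_open_measurable (O : set MR2) : box_open O -> measurable O.
Proof.
move=> Oo.
pose box (i : rat * rat * (rat * rat)) : set MR2 :=
  [set` Interval (BRight (ratr i.1.1 : R)) (BLeft (ratr i.1.2 : R))] `*`
  [set` Interval (BRight (ratr i.2.1 : R)) (BLeft (ratr i.2.2 : R))].
rewrite (_ : O = \bigcup_i (if pselect (box i `<=` O) then box i else set0)).
  apply: countable_bigcupT_measurable => [|i]; first exact: countableP.
  case: pselect => ?; last exact: measurable0.
  by apply: measurableX; exact: measurable_itv.
apply/seteqP; split => [[x y] Oxy|z [i _]]; last by case: pselect => // bO; exact: bO.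
have [d [d0 Hd]] := Oo x y Oxy.
have lt1 t : (t - d < t)%R by apply/RltP; rewrite -RminusE; lra.
have lt2 t : (t < t + d)%R by apply/RltP; rewrite -RplusE; lra.
have [a /[!in_itv]/= /andP[/RltP + /RltP +]] := rat_in_itvoo (lt1 x).
have [b /[!in_itv]/= /andP[/RltP + /RltP +]] := rat_in_itvoo (lt2 x).
have [c /[!in_itv]/= /andP[/RltP + /RltP +]] := rat_in_itvoo (lt1 y).
have [e /[!in_itv]/= /andP[/RltP + /RltP +]] := rat_in_itvoo (lt2 y).
rewrite -!RminusE -!RplusE => e1 e2 c1 c2 b1 b2 a1 a2.
exists ((a, b), (c, e)) => //; case: pselect => [?|[]]; last first.

  move=> -[u v] [] /=; rewrite !in_itv /= => /andP[/RltP u1 /RltP u2] /andP[/RltP v1 /RltP v2].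
  by apply: Hd; [exact: (Rabs_lt_itv a1 b2 u1 u2)|exact: (Rabs_lt_itv c1 e2 v1 v2)].
by split; rewrite /= in_itv /=; apply/andP; split; apply/RltP.
Qed.

Lemma box_open_upper : box_open [set z : MR2 | upper z].
Proof.
move=> x y /= xy; exists y; split=> // u v _; rewrite /upper /= => /Rabs_def2; lra.
Qed.

Lemma measurable_upper : measurable ([set z | upper z] : set MR2).
Proof. exact: (box_open_measurable _ box_open_upper). Qed.

Lemma measurable_fun_box_continuous (D : set MR2) (u : MR2 -> MR) : box_open D ->
  (forall x y, D (x, y) -> forall eps, 0 < eps -> exists d, 0 < d /\
     forall s t, Rabs (s - x) < d -> Rabs (t - y) < d -> Rabs (u (s, t) - u (x, y)) < eps) ->
  measurable_fun D u.
Proof.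
move=> Do cu; apply: (measurability _ (RGenOInfty.measurableE R)) => _ [_ [a ->] <-].
apply: box_open_measurable => x y [Dxy]; rewrite /= in_itv /= andbT => /RltP ua.
have [d [d0 Hd]] := Do x y Dxy.
have [|e [e0 He]] := cu x y Dxy (u (x, y) - a); first exact: Rlt_Rminus.
exists (Rmin d e); split; first exact: Rmin_pos.
move=> s t Hs Ht; have l1 := Rmin_l d e; have l2 := Rmin_r d e.
split; first by apply: Hd; [exact: Rlt_le_trans Hs l1|exact: Rlt_le_trans Ht l1].
rewrite /= in_itv /= andbT; apply/RltP.
apply: Rabs_lt_minus_gt; apply: (He s t); [exact: Rlt_le_trans Hs l2|exact: Rlt_le_trans Ht l2].
Qed.

(** * The sub-mean value property *)

Definition dens (Phi : R -> R) (gam lam : R) (f : C -> C) (z : C) : R :=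
  Phi (Cmod (f z) / lam) * Rpower (snd z) gam.

Lemma PhiIntE Phi gam lam f :
  PhiInt Phi gam lam f = (\int[leb2]_(z in [set z : MR2 | upper z]) (dens Phi gam lam f z)%:E)%E.
Proof. by []. Qed.

Lemma measurable_Cmod (D : set MR2) f : box_open D -> (forall x y, D (x, y) -> holo_at f (x, y)) ->
  measurable_fun D ((fun z => Cmod (f z)) : MR2 -> MR).
Proof.
move=> oD hf; apply: measurable_fun_box_continuous => // x y Dxy eps eps0.
exact: holo_at_Cmod_continuous (hf _ _ Dxy) eps eps0.
Qed.

Lemma measurable_snd_continuous (v : R -> R) : (forall y, 0 < y -> continuity_pt v y) ->
  measurable_fun [set z : MR2 | upper z] ((fun z => v z.2) : MR2 -> MR).
Proof.
move=> cv; apply: measurable_fun_box_continuous; first exact: box_open_upper.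
move=> x y /= xy eps eps0; have [d [d0 Hd]] := cv y xy eps eps0.
exists d; split=> // s t _ ht.
case: (Req_dec t y) => [->|ty]; first by rewrite Rminus_eq_0 Rabs_R0.
by apply: Hd; split=> //; split=> // yt; exact/ty.
Qed.

Lemma measurable_dens Phi gam lam f : growth Phi -> holo f -> 0 < lam ->
  measurable_fun [set z : MR2 | upper z] (dens Phi gam lam f : MR2 -> MR).
Proof.
move=> gP hf lam0; apply: measurable_funM.
  apply: measurable_fun_box_continuous; first exact: box_open_upper.
  move=> x y /= xy eps eps0.
  have pos z : 0 <= Cmod (f z) / lam by apply: Rle_mult_inv_pos => //; apply: Cmod_ge_0.
  have [d [d0 Hd]] := gP.1 (Cmod (f (x, y)) / lam) (pos _) eps eps0.
  have [e [e0 He]] := holo_at_Cmod_continuous f x y (holo_holo_at f hf x y xy) (d * lam) ltac:(nra).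
  exists e; split=> // s t hs ht; apply: Hd => //.
  rewrite /Rdiv -Rmult_minus_distr_r Rabs_mult (Rabs_pos_eq (/ lam)); last first.
    by left; apply: Rinv_0_lt_compat.
  apply: (Rmult_lt_reg_r lam) => //; rewrite Rmult_assoc Rinv_l ?Rmult_1_r; [exact: He|lra].
apply: (measurable_snd_continuous (fun y => Rpower y gam)) => y yp; apply: derivable_continuous_pt.
by exists (gam * Rpower y (gam - 1)); exact: derivable_pt_lim_power.
Qed.

Lemma dens_ge0 Phi gam lam f z : growth Phi -> 0 < lam -> 0 <= dens Phi gam lam f z.
Proof.
move=> gP lam0; apply: Rmult_le_pos; last by left; exact: exp_pos.
by apply: gP.2.2.1; apply: Rle_mult_inv_pos => //; apply: Cmod_ge_0.
Qed.

Lemma le_dens_PhiInt Phi Psi gam del lam mu f g : growth Phi -> growth Psi -> holo f -> holo g ->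
  0 < lam -> 0 < mu -> (forall z, upper z -> dens Phi gam lam f z <= dens Psi del mu g z) ->
  (PhiInt Phi gam lam f <= PhiInt Psi del mu g)%E.
Proof.
move=> gP gQ hf hg l0 m0 H; rewrite !PhiIntE; apply: ge0_le_integral.
- exact: measurable_upper.
- by move=> z _; rewrite lee_fin; apply/RleP; exact: dens_ge0.
- by apply/measurable_EFinP; exact: measurable_dens.
- by apply/measurable_EFinP; exact: measurable_dens.
- by move=> z uz; rewrite lee_fin; apply/RleP; exact: H.
Qed.

Definition square p q r : set MR2 := `[p - r, p + r]%classic `*` `[q - r, q + r]%classic.

Lemma measurable_square p q r : measurable (square p q r).
Proof. by apply: measurableX; exact: measurable_itv. Qed.

Lemma squareP p q r x y : square p q r (x, y) <-> (p - r <= x <= p + r) /\ (q - r <= y <= q + r).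
Proof.
rewrite /square /=; split; first by case; rewrite /= !in_itv /= => /andP[/RleP ? /RleP ?] /andP[/RleP ? /RleP ?].
by move=> [[? ?] [? ?]]; split; rewrite /= in_itv /=; apply/andP; split; apply/RleP.
Qed.

Lemma integral_itv_cst (s t k : R) : s < t -> (\int[leb]_(x in `[s, t]) k%:E = (k * (t - s))%coqR%:E)%E.
Proof.
move=> st; rewrite (integral_RInt (fun=> k)) //; last by move=> *; exact: continuous_const.
by rewrite RInt_const; congr (EFin _); rewrite /Hierarchy.scal /= /mult /=; exact: Rmult_comm.
Qed.

Section area.
Variables (f : C -> C) (p q r : R).
Hypothesis r0 : 0 < r.
Hypothesis rq : r < q.
Hypothesis hf : holo f.

(** Extension by zero, so that Tonelli's theorem can be applied on the whole plane. *)
Let h : MR2 -> \bar R := (fun z : MR2 => (Cmod (f z))%:E) \_ (square p q r).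

Let square_upper : square p q r `<=` [set z : MR2 | upper z].
Proof. by move=> [x y] /squareP; rewrite /upper /=; lra. Qed.

Lemma measurable_Cmod_square : measurable_fun (square p q r) (fun z : MR2 => (Cmod (f z))%:E).
Proof.
apply/measurable_EFinP.
apply: (measurable_funS measurable_upper square_upper).
by apply: measurable_Cmod; [exact: box_open_upper|exact: holo_holo_at].
Qed.

Let mh : measurable_fun setT h.
Proof. exact: ((measurable_restrictT _ (measurable_square p q r)).1 measurable_Cmod_square). Qed.

Let h0 z : (0 <= h z)%E.
Proof. by apply: erestrict_ge0 => x _; rewrite lee_fin; apply/RleP; exact: Cmod_ge_0. Qed.

Let integral_h : (\int[leb2]_(z in square p q r) (Cmod (f z))%:E = \int[leb2]_z h z)%E.
Proof. by rewrite integral_mkcond. Qed.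

(** Tonelli, keeping only the strip between s and t. Read by contraposition: a small area integral
    yields a vertical segment in the strip with a small line integral. *)
Lemma mean_value_slice_x s t k : p - r <= s -> s < t -> t <= p + r -> 0 <= k ->
  (forall x, s <= x <= t -> k <= RInt (fun y => Cmod (f (x, y))) (q - r) (q + r)) ->
  ((k * (t - s))%coqR%:E <= \int[leb2]_(z in square p q r) (Cmod (f z))%:E)%E.
Proof.
move=> ps st tp k0 H; rewrite integral_h fubini_tonelli1 //.
have mF := @measurable_fun_fubini_tonelli_F _ _ MR MR R leb h mh h0.
have F0 x : (0 <= fubini_F leb h x)%E by apply: integral_ge0 => y _; exact: h0.
apply: (@le_trans _ _ (\int[leb]_(x in `[s, t]) fubini_F leb h x)%E); last first.
  by apply: ge0_subset_integral => //; exact: measurable_itv.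
apply: (@le_trans _ _ (\int[leb]_(x in `[s, t]) k%:E)%E).
  by rewrite integral_itv_cst.
apply: ge0_le_integral.
- exact: measurable_itv.
- by move=> x _; rewrite lee_fin; apply/RleP.
- exact: measurable_cst.
- exact: measurable_funTS.
move=> x; rewrite /= in_itv /= => /andP[/RleP sx /RleP xt].
rewrite /fubini_F (_ : (\int[leb]_y h (x, y) = \int[leb]_(y in `[(q - r)%coqR, (q + r)%coqR]) (Cmod (f (x, y)))%:E)%E).
  rewrite (integral_RInt (fun y => Cmod (f (x, y)))); [|lra|].
    by rewrite lee_fin; apply/RleP; exact: H.
  by move=> y yq; apply: holo_at_continuous_y; apply: holo_holo_at => //; lra.
rewrite [RHS]integral_mkcond; apply: eq_integral => y _.
rewrite /h !patchE; congr (if _ then _ else _).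
apply/idP/idP; rewrite !inE; first by case/squareP => _ [? ?]; rewrite /= in_itv /=; apply/andP; split; apply/RleP.
by rewrite /= in_itv /= => /andP[/RleP ? /RleP ?]; apply/squareP; split; [lra|].
Qed.

Lemma mean_value_slice_y s t k : q - r <= s -> s < t -> t <= q + r -> 0 <= k ->
  (forall y, s <= y <= t -> k <= RInt (fun x => Cmod (f (x, y))) (p - r) (p + r)) ->
  ((k * (t - s))%coqR%:E <= \int[leb2]_(z in square p q r) (Cmod (f z))%:E)%E.
Proof.
move=> ps st tp k0 H; rewrite integral_h fubini_tonelli2 //.
have mF := @measurable_fun_fubini_tonelli_G _ _ MR MR R leb h mh h0.
have F0 x : (0 <= fubini_G leb h x)%E by apply: integral_ge0 => y _; exact: h0.
apply: (@le_trans _ _ (\int[leb]_(x in `[s, t]) fubini_G leb h x)%E); last first.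
  by apply: ge0_subset_integral => //; exact: measurable_itv.
apply: (@le_trans _ _ (\int[leb]_(x in `[s, t]) k%:E)%E).
  by rewrite integral_itv_cst.
apply: ge0_le_integral.
- exact: measurable_itv.
- by move=> x _; rewrite lee_fin; apply/RleP.
- exact: measurable_cst.
- exact: measurable_funTS.
move=> y; rewrite /= in_itv /= => /andP[/RleP sx /RleP xt].
rewrite /fubini_G (_ : (\int[leb]_x h (x, y) = \int[leb]_(x in `[(p - r)%coqR, (p + r)%coqR]) (Cmod (f (x, y)))%:E)%E).
  rewrite (integral_RInt (fun x => Cmod (f (x, y)))); [|lra|].
    by rewrite lee_fin; apply/RleP; exact: H.
  by move=> x yq; apply: holo_at_continuous_x; apply: holo_holo_at => //; lra.
rewrite [RHS]integral_mkcond; apply: eq_integral => x _.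
rewrite /h !patchE; congr (if _ then _ else _).
apply/idP/idP; rewrite !inE; first by case/squareP => [[? ?]] _; rewrite /= in_itv /=; apply/andP; split; apply/RleP.
by rewrite /= in_itv /= => /andP[/RleP ? /RleP ?]; apply/squareP; split; [|lra].
Qed.

(* If each of the four averaging strips contained a side with integral below
   |f(p,q)| r / 8, the rectangle with these sides would violate the Cauchy estimate. *)
Lemma mean_value_square :
  ((Cmod (f (p, q)) * r * r / 16)%coqR%:E <= \int[leb2]_(z in square p q r) (Cmod (f z))%:E)%E.
Proof.
(* The Cauchy estimate forces four side integrals to add up to at least 4 k, and each strip has
   width r/2, whence the bound k r / 2. *)
set k := Cmod (f (p, q)) * r / 8.
have k0 : 0 <= k by apply: Rle_mult_inv_pos; [apply: Rmult_le_pos; [exact: Cmod_ge_0|lra]|lra].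
have -> : Cmod (f (p, q)) * r * r / 16 = k * (r / 2) by rewrite /k; field.
rewrite leNgt; apply/negP => lt.
have pt (P : R -> R) s t : s <= t -> t - s = r / 2 ->
    ((forall x, s <= x <= t -> k <= P x) -> ((k * (t - s))%coqR%:E <= \int[leb2]_(z in square p q r) (Cmod (f z))%:E)%E) ->
    exists2 x, s <= x <= t & P x < k.
  move=> st ts H; apply: contrapT => nex.
  have := H _; rewrite ts leNgt lt => /(_ _)/negP; apply=> //.
  by move=> x xst; apply: Rnot_lt_le => Px; apply: nex; exists x.
have [p1 Hp1 P1] := pt (fun x => RInt (fun y => Cmod (f (x, y))) (q - r) (q + r)) (p - r) (p - r / 2)
  ltac:(lra) ltac:(lra) (mean_value_slice_x (p - r) (p - r / 2) k ltac:(lra) ltac:(lra) ltac:(lra) k0).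
have [p2 Hp2 P2] := pt (fun x => RInt (fun y => Cmod (f (x, y))) (q - r) (q + r)) (p + r / 2) (p + r)
  ltac:(lra) ltac:(lra) (mean_value_slice_x (p + r / 2) (p + r) k ltac:(lra) ltac:(lra) ltac:(lra) k0).
have [q1 Hq1 Q1] := pt (fun y => RInt (fun x => Cmod (f (x, y))) (p - r) (p + r)) (q - r) (q - r / 2)
  ltac:(lra) ltac:(lra) (mean_value_slice_y (q - r) (q - r / 2) k ltac:(lra) ltac:(lra) ltac:(lra) k0).
have [q2 Hq2 Q2] := pt (fun y => RInt (fun x => Cmod (f (x, y))) (p - r) (p + r)) (q + r / 2) (q + r)
  ltac:(lra) ltac:(lra) (mean_value_slice_y (q + r / 2) (q + r) k ltac:(lra) ltac:(lra) ltac:(lra) k0).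
have := Cauchy_estimate_rect f p q r p1 p2 q1 q2 r0 Hp1 Hp2 Hq1 Hq2.
have hol x y : p - r <= x <= p + r -> q - r <= y <= q + r -> holo_at f (x, y).
  by move=> _ ?; apply: holo_holo_at => //; lra.
by move=> /(_ hol); rewrite (_ : Cmod (f (p, q)) * r / 2 = 4 * k); [lra|rewrite /k; field].
Qed.

End area.

(** On the square of half-side q/2 the weight is comparable with its value at the centre. The two
    entries of the minimum serve gam >= 0 and gam < 0. *)
Lemma Rpower_half_ge gam y q : 0 < q -> q / 2 <= y <= 3 * q / 2 ->
  Rmin (Rpower (1 / 2) gam) (Rpower (3 / 2) gam) * Rpower q gam <= Rpower y gam.
Proof.
move=> q0 yq.
have -> : Rpower y gam = Rpower (y / q) gam * Rpower q gam.
  rewrite Rpower_mult_distr //; first by congr Rpower; field; lra.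
  by apply: Rdiv_lt_0_compat; lra.
apply: Rmult_le_compat_r; first by left; exact: exp_pos.
have l1 : 1 / 2 <= y / q by apply: (Rmult_le_reg_r q) => //; rewrite /Rdiv Rmult_assoc (Rmult_assoc y) Rinv_l; lra.
have l2 : y / q <= 3 / 2 by apply: (Rmult_le_reg_r q) => //; rewrite /Rdiv Rmult_assoc Rinv_l; lra.
case: (Rle_dec 0 gam) => g0.
  by apply: Rle_trans (Rmin_l _ _) _; apply: Rle_Rpower_l => //; lra.
apply: Rle_trans (Rmin_r _ _) _.
rewrite -(Ropp_involutive gam) !(Rpower_Ropp _ (- gam)).
apply: Rinv_le_contravar; first exact: exp_pos.
by apply: Rle_Rpower_l; lra.
Qed.

Lemma leb2_square p q r : 0 < r -> leb2 (square p q r) = (2 * r * (2 * r))%coqR%:E.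
Proof.
move=> r0; rewrite /square product_measure1E; [|exact: measurable_itv|exact: measurable_itv].
have E (t : R) : leb (`[(t - r)%coqR, (t + r)%coqR]%classic : set MR) = (2 * r)%coqR%:E.
  transitivity (\int[leb]_(x in `[(t - r)%coqR, (t + r)%coqR]) 1%coqR%:E)%E.
    by rewrite integral_cst ?mul1e //; exact: measurable_itv.
  have -> : 2 * r = 1 * (t + r - (t - r)) by ring.
  by rewrite integral_itv_cst //; lra.
by transitivity ((2 * r)%coqR%:E * (2 * r)%coqR%:E)%E; [congr mule; exact: E|rewrite -EFinM].
Qed.

Lemma Rpower_2_add x e : 0 < x -> Rpower x (2 + e) = x * x * Rpower x e.
Proof. by move=> x0; rewrite Rpower_plus (_ : 2 = INR 2) // Rpower_pow //= Rmult_1_r. Qed.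

(* Integrate |F| <= lam m + (lam m / Phi m) Phi(|F| / lam) over the square of half-side q/2. *)
Lemma pointwise_estimate gam : exists c, 0 < c /\ forall Phi F lam p q, inU Phi -> holo F ->
  0 < lam -> (PhiInt Phi gam lam F <= 1)%E -> 0 < q ->
  Phi (Cmod (F (p, q)) / (128 * lam)) <= c * / Rpower q (2 + gam).
Proof.
set c := Rmin (Rpower (1 / 2) gam) (Rpower (3 / 2) gam).
have c0 : 0 < c by apply: Rmin_pos; exact: exp_pos.
exists (/ c); split; first exact: Rinv_0_lt_compat.
move=> Phi F lam p q UP hF lam0 int1 q0.
have gP := inU_growth _ UP.
(* On half-side q/2 the mean value inequality has left side |F(p,q)| q^2 / 64 = 2 lam m q^2, twice
   the integral of the constant lam m over the square. Half of it therefore survives the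
   subtraction, giving lam m q^2 <= K. *)
set m := Cmod (F (p, q)) / (128 * lam).
have E0 : Cmod (F (p, q)) = 128 * lam * m by rewrite /m; field; lra.
have : 0 <= m by apply: Rle_mult_inv_pos; [exact: Cmod_ge_0|lra].
case=> [m0|<-]; last first.
  rewrite growth_0 //; apply: Rmult_le_pos; left; apply: Rinv_0_lt_compat => //; exact: exp_pos.
have Pm := inU_pos _ _ UP m0.
have pq0 : 0 < Rpower q gam by exact: exp_pos.
set K := lam * m / (Phi m * (c * Rpower q gam)).
have K0 : 0 < K by apply: Rdiv_lt_0_compat; [exact: Rmult_lt_0_compat|repeat apply: Rmult_lt_0_compat].
have r0 : 0 < q / 2 by lra.
have rq : q / 2 < q by lra.
have MV := mean_value_square F p q (q / 2) r0 rq hF.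
pose D := dens Phi gam lam F.
have sub : square p q (q / 2) `<=` [set z : MR2 | upper z].
  by move=> [x y] /squareP; rewrite /upper /=; lra.
have mD : measurable_fun [set z : MR2 | upper z] (fun z => (D z)%:E).
  by apply/measurable_EFinP; exact: measurable_dens.
have mD' : measurable_fun (square p q (q / 2)) (fun z => (D z)%:E).
  exact: (measurable_funS measurable_upper sub).
have D0 z : (0 <= (D z)%:E)%E by rewrite lee_fin; apply/RleP; exact: dens_ge0.
have ptw' (x y : R) : square p q (q / 2) (x, y) -> Cmod (F (x, y)) <= lam * m + K * D (x, y).
  move=> /squareP [_ yq].
  have U := inU_young Phi m (Cmod (F (x, y)) / lam) UP m0.
  have := U (Rle_mult_inv_pos _ _ (Cmod_ge_0 _) lam0) => {}U.
  have Pu : 0 <= Phi (Cmod (F (x, y)) / lam).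
    by apply: gP.2.2.1; apply: Rle_mult_inv_pos => //; exact: Cmod_ge_0.
  have R := Rpower_half_ge gam y q q0 ltac:(lra).
  rewrite -/c in R.
  have L1 : Cmod (F (x, y)) <= lam * m + lam * m / Phi m * Phi (Cmod (F (x, y)) / lam).
    have -> : Cmod (F (x, y)) = lam * (Cmod (F (x, y)) / lam) by field; lra.
    rewrite {2}(_ : lam * (Cmod (F (x, y)) / lam) = Cmod (F (x, y))); last by field; lra.
    rewrite (_ : lam * m + _ = lam * (m + m / Phi m * Phi (Cmod (F (x, y)) / lam))); last by field; lra.
    by apply: Rmult_le_compat_l; lra.
  apply: (Rle_trans _ _ _ L1); apply: Rplus_le_compat_l.
  rewrite /D /dens /= (_ : K * _ = lam * m / Phi m * (Phi (Cmod (F (x, y)) / lam) * (Rpower y gam / (c * Rpower q gam)))); last first.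
    by rewrite /K; field; repeat split; lra.
  apply: Rmult_le_compat_l; first by left; apply: Rdiv_lt_0_compat => //; exact: Rmult_lt_0_compat.
  rewrite -[X in X <= _]Rmult_1_r; apply: Rmult_le_compat_l => //.
  have cq : 0 < c * Rpower q gam by exact: Rmult_lt_0_compat.
  by apply: (Rmult_le_reg_r (c * Rpower q gam)) => //; rewrite /Rdiv Rmult_assoc Rinv_l; lra.
have ptw z : square p q (q / 2) z -> Cmod (F z) <= lam * m + K * D z by case: z; exact: ptw'.
have : ((Cmod (F (p, q)) * (q / 2) * (q / 2) / 16)%coqR%:E <= (lam * m * (q * q) + K)%coqR%:E)%E.
  apply: (le_trans MV).
  apply: (@le_trans _ _ (\int[leb2]_(z in square p q (q / 2)) ((lam * m)%coqR%:E + K%:E * (D z)%:E))%E).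
    apply: ge0_le_integral.
    - exact: measurable_square.
    - by move=> z _; rewrite lee_fin; apply/RleP; exact: Cmod_ge_0.
    - exact: measurable_Cmod_square.
    - by apply: emeasurable_funD; [exact: measurable_cst|exact: measurable_funeM].
    - by move=> z /ptw H; rewrite -EFinM -EFinD lee_fin; apply/RleP.
  rewrite ge0_integralD; first last.
  - exact: measurable_funeM.
  - by move=> z _; apply: mule_ge0 => //; rewrite lee_fin; apply/RleP; exact: Rlt_le.
  - exact: measurable_cst.
  - by move=> z _; rewrite lee_fin; apply/RleP; apply: Rmult_le_pos; exact: Rlt_le.
  - exact: measurable_square.
  rewrite integral_cst; last exact: measurable_square.
  rewrite [X in (_ * X + _)%E](_ : _ = (q * q)%coqR%:E); last first.
    have -> : q * q = 2 * (q / 2) * (2 * (q / 2)) by field.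
    exact: leb2_square.
  rewrite ge0_integralZl //; last 2 first.
  - exact: measurable_square.
  - by rewrite lee_fin; apply/RleP; exact: Rlt_le.
  rewrite -EFinM EFinD; apply: leeD => //.
  rewrite -[leRHS]mule1; apply: lee_wpmul2l; first by rewrite lee_fin; apply/RleP; exact: Rlt_le.
  apply: le_trans int1; rewrite PhiIntE.
  by apply: ge0_subset_integral => //; [exact: measurable_square|exact: measurable_upper].
rewrite lee_fin => /RleP; rewrite E0 => fin.
have fin2 : lam * m * (q * q) <= K by nra.
rewrite Rpower_2_add //.
have qq : 0 < q * q by nra.
apply: (Rmult_le_reg_r (c * (q * q * Rpower q gam))); first by repeat apply: Rmult_lt_0_compat.
rewrite (_ : / c * _ * _ = 1); last by field; repeat split; lra.
apply: (Rmult_le_reg_l (lam * m / Phi m / (c * Rpower q gam))).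
  apply: Rdiv_lt_0_compat; last exact: Rmult_lt_0_compat.
  by apply: Rdiv_lt_0_compat => //; exact: Rmult_lt_0_compat.
rewrite Rmult_1_r (_ : lam * m / Phi m / (c * Rpower q gam) = K); last by rewrite /K; field; repeat split; lra.
rewrite (_ : K * _ = lam * m * (q * q)) //; by rewrite /K; field; repeat split; lra.
Qed.

(** * Test functions *)

Lemma Rpower_div x y e : 0 < x -> 0 < y -> Rpower (x / y) e = Rpower x e / Rpower y e.
Proof.
move=> x0 y0; rewrite /Rdiv -Rpower_mult_distr //; last exact: Rinv_0_lt_compat.
by congr (_ * _); rewrite /Rpower ln_Rinv // -exp_Ropp; congr exp; ring.
Qed.

Lemma Rpower_1_add x e : 0 < x -> Rpower x (e + 1) = Rpower x e * x.
Proof. by move=> x0; rewrite Rpower_plus Rpower_1. Qed.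

Lemma Rpower_le_exponent t a b : 0 < t <= 1 -> b <= a -> Rpower t a <= Rpower t b.
Proof.
move=> [t0 t1] ba; have L : Rpower.ln t <= 0.
  by case: t1 => [t1|->]; [left; rewrite -ln_1; exact: ln_increasing|rewrite ln_1; right].
have : a * Rpower.ln t <= b * Rpower.ln t by nra.
by rewrite /Rpower; case=> [/exp_increasing|->]; [left|right].
Qed.

(** Improper integrals by exhaustion: the fundamental theorem on each compact interval, then
    monotone convergence. A uniform bound on the increments of F suffices, no limit has to be
    computed. *)
Lemma integral_le_antiderivative (D : set MR) (f F : R -> R) (M : R) (a b : nat -> R) :
  D = \bigcup_n `[a n, b n]%classic ->
  (forall n m, (n <= m)%N -> a m <= a n /\ b n <= b m) -> (forall n, a n < b n) ->
  (forall n x, a n <= x <= b n -> Derive.is_derive F x (f x) /\ Continuity.continuous f x /\ 0 <= f x) ->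
  (forall n, F (b n) - F (a n) <= M) ->
  measurable_fun D (f : MR -> MR) ->
  (\int[leb]_(x in D) (f x)%:E <= M%:E)%E.
Proof.
move=> DE mono ab H HM mf.
have ge0 n x : `[a n, b n]%classic x -> (0 <= (f x)%:E)%E.
  rewrite /= in_itv /= => /andP[/RleP h1 /RleP h2]; rewrite lee_fin; apply/RleP.
  by have [_ [_]] := H n x (conj h1 h2).
have mD n : measurable (`[a n, b n]%classic : set MR) by exact: measurable_itv.
have mfn n : measurable_fun (`[a n, b n]%classic : set MR) (fun x => (f x)%:E).
  apply/measurable_EFinP; apply: (measurable_funS _ _ mf).
    by rewrite DE; exact: bigcupT_measurable.
  by rewrite DE; exact: (@classical_sets.bigcup_sup _ _ n setT (fun n => `[a n, b n]%classic)).
have nd : nondecreasing_seq (fun n => `[a n, b n]%classic : set MR).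
  move=> n m nm; rewrite subsetEset => x; rewrite /= !in_itv /= => /andP[/RleP h1 /RleP h2].
  by have [? ?] := mono n m nm; apply/andP; split; apply/RleP; [exact: Rle_trans h1|exact: Rle_trans h2 _].
have cv := ge0_nondecreasing_set_cvg_integral (mu := leb) nd mD mfn ge0.
rewrite -DE in cv.
apply: (cvge_le _ cv); apply: nearW => n.
rewrite (integral_RInt f) //; last by move=> x /H [_ []].
rewrite lee_fin; apply/RleP; apply: Rle_trans (HM n).
right; have I := is_RInt_derive (V := R_CompleteNormedModule) F f (a n) (b n).
apply: is_RInt_unique; apply: I => x.
  by rewrite Rmin_left ?Rmax_right; [move=> /H []|left|left].
by rewrite Rmin_left ?Rmax_right; [move=> /H [_ []]|left|left].
Qed.

Lemma measurable_fun_continuous (D : set MR) (f : R -> R) : open (D : set R) ->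
  (forall x, D x -> Continuity.continuous f x) -> measurable_fun D (f : MR -> MR).
Proof.
move=> oD cf; apply: open_continuous_measurable_fun => // x /[!inE] Dx.
exact: Coquelicot_continuous_continuous (cf _ Dx).
Qed.

Lemma INR_unbounded (x : R) : exists n : nat, x < INR n.
Proof. by have [n Hn] := INR_archimed 1 x Rlt_0_1; exists n; lra. Qed.

(** The primitive k arctan((x - x0) / Y) has increments at most k pi, whatever the height Y. *)
Lemma integral_poisson_le x0 Y k : 0 < Y -> 0 <= k ->
  (\int[leb]_(x in setT) (k * (Y / ((x - x0) * (x - x0) + Y * Y)))%coqR%:E <= (k * PI)%coqR%:E)%E.
Proof.
move=> Y0 k0.
have den x : 0 < (x - x0) * (x - x0) + Y * Y.
  by have := Rle_0_sqr (x - x0); have := Rmult_lt_0_compat _ _ Y0 Y0; rewrite /Rsqr; lra.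
have cf x : Continuity.continuous (fun x => k * (Y / ((x - x0) * (x - x0) + Y * Y))) x.
  apply: (ex_derive_continuous (K := R_AbsRing) (V := R_NormedModule)).
  by auto_derive; have := den x; move=> *; apply: Rgt_not_eq; lra.
apply: (@integral_le_antiderivative setT _ (fun x => k * Ratan.atan ((x - x0) / Y)) _ (fun n => - (INR n + 1)) (fun n => INR n + 1)).
- apply/seteqP; split=> // x _.
  have [n Hn] := INR_unbounded (Rabs x); exists n => //=; rewrite in_itv /=.
  by move: Hn; rewrite /Rabs; case: Rcase_abs => ? ?; apply/andP; split; apply/RleP; lra.
- by move=> n m nm; have := le_INR _ _ (elimT ssrnat.leP nm); lra.
- by move=> n; have := pos_INR n; lra.
- move=> n x _; split; last first.
    by split=> //; apply: Rmult_le_pos => //; apply: Rle_mult_inv_pos => //; lra.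
  have dx := den x.
  auto_derive; first lra.
  by field; split; apply: Rgt_not_eq; lra.
- move=> n; have := atan_bound ((INR n + 1 - x0) / Y); have := atan_bound ((- (INR n + 1) - x0) / Y).
  by nra.
- by apply: measurable_fun_continuous => // ; exact: openT.
Qed.

(** This is y0 y^al / (y + y0)^(al+2), written with s = y / (y + y0) as s^al times ds/dy. Its
    primitive is s^(al+1) / (al+1), and s runs from 0 to 1, so its integral is bounded independently
    of y0. *)
Definition test_weight (al y0 y : R) : R := y0 * Rpower (y / (y + y0)) al / ((y + y0) * (y + y0)).

Lemma is_derive_test_weight al y0 y : 0 < y0 -> 0 < y -> 0 < al + 1 ->
  Derive.is_derive (fun y => / (al + 1) * Rpower (y / (y + y0)) (al + 1)) y (test_weight al y0 y).
Proof.
move=> y00 yp al1.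
have q0 : 0 < y / (y + y0) by apply: Rdiv_lt_0_compat; lra.
rewrite /test_weight /Rpower; auto_derive; first by repeat split; lra.
rewrite (_ : (al + 1) * Rpower.ln (y / (y + y0)) = al * Rpower.ln (y / (y + y0)) + Rpower.ln (y / (y + y0))); last by ring.
rewrite exp_plus exp_ln //; field; repeat split; lra.
Qed.

Lemma test_weight_continuous al y0 y : 0 < y0 -> 0 < y -> Continuity.continuous (test_weight al y0) y.
Proof.
move=> y00 yp; apply: (ex_derive_continuous (K := R_AbsRing) (V := R_NormedModule)).
have q0 : 0 < y / (y + y0) by apply: Rdiv_lt_0_compat; lra.
rewrite /test_weight /Rpower; auto_derive; repeat split; try lra.
by apply: Rgt_not_eq; apply: Rmult_lt_0_compat; lra.
Qed.

Lemma test_weight_ge0 al y0 y : 0 < y0 -> 0 < y -> 0 <= test_weight al y0 y.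
Proof.
move=> y00 yp; apply: Rle_mult_inv_pos; last by apply: Rmult_lt_0_compat; lra.
by apply: Rmult_le_pos; [lra|left; exact: exp_pos].
Qed.

Lemma measurable_test_weight al y0 k : 0 < y0 ->
  measurable_fun (`]0%coqR, +oo[%classic : set MR) ((fun y => k * test_weight al y0 y) : MR -> MR).
Proof.
move=> y00; apply: measurable_fun_continuous; first exact: interval_open.
move=> y; rewrite /= in_itv /= andbT => /RltP yp.
by apply: (continuous_scal_r (V := R_NormedModule) k); exact: test_weight_continuous.
Qed.

Lemma integral_test_weight_le al y0 k : 0 < y0 -> 0 < al + 1 -> 0 <= k ->
  (\int[leb]_(y in `]0%coqR, +oo[) (k * test_weight al y0 y)%coqR%:E <= (k * / (al + 1))%coqR%:E)%E.
Proof.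
move=> y00 al1 k0.
have np n : 0 < INR n + 1 by have := pos_INR n; lra.
have ip n : 0 < / (INR n + 1) by exact: Rinv_0_lt_compat.
have F01 y : 0 < y -> 0 <= Rpower (y / (y + y0)) (al + 1) <= 1.
  move=> yp; split; first by left; exact: exp_pos.
  have q0 : 0 < y / (y + y0) by apply: Rdiv_lt_0_compat; lra.
  rewrite -[X in _ <= X](Rpower_O (y / (y + y0))) //; apply: Rpower_le_exponent; last lra.
  split=> //; apply: (Rmult_le_reg_r (y + y0)); first lra.
  by rewrite /Rdiv Rmult_assoc Rinv_l; lra.
have ai : 0 < / (al + 1) by exact: Rinv_0_lt_compat.
(* The right end is n + 2 because n + 1 would reduce the interval for n = 0 to a point. *)
apply: (@integral_le_antiderivative _ _ (fun y => k * (/ (al + 1) * Rpower (y / (y + y0)) (al + 1))) _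
  (fun n => / (INR n + 1)) (fun n => INR n + 2)).
- apply/seteqP; split=> y /=.
    rewrite in_itv /= andbT => /RltP yp.
    have [n Hn] := INR_unbounded (y + / y).
    have yi : 0 < / y by exact: Rinv_0_lt_compat.
    exists n => //=; rewrite in_itv /=; apply/andP; split; apply/RleP; last lra.
    by rewrite -(Rinv_inv y); apply: Rinv_le_contravar => //; lra.
  case=> n _ /=; rewrite !in_itv /= andbT => /andP[/RleP h1 _]; apply/RltP.
  exact: Rlt_le_trans (ip n) h1.
- move=> n m nm; have := le_INR _ _ (elimT ssrnat.leP nm) => ?; split; last lra.
  by apply: Rinv_le_contravar => //; lra.
- move=> n; have : / (INR n + 1) <= 1 by rewrite -Rinv_1; apply: Rinv_le_contravar; have := pos_INR n; lra.
  by have := np n; lra.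
- move=> n y [y1 _]; have yp : 0 < y by exact: Rlt_le_trans (ip n) y1.
  split; first by apply: is_derive_scal; exact: is_derive_test_weight.
  split; first by apply: (continuous_scal_r (V := R_NormedModule) k); exact: test_weight_continuous.
  by apply: Rmult_le_pos => //; exact: test_weight_ge0.
- move=> n; have [_ h1] := F01 (INR n + 2) ltac:(have := np n; lra); have [h2 _] := F01 (/ (INR n + 1)) (ip n).
  rewrite -Rmult_minus_distr_l -Rmult_minus_distr_l; apply: Rmult_le_compat_l => //.
  by rewrite -[X in _ <= X]Rmult_1_r; apply: Rmult_le_compat_l; lra.
- exact: measurable_test_weight.
Qed.

(** By strict monotonicity the set in the definition of [ginv] is the interval [0, t]. *)
Lemma ginv_eq Phi t y : inU Phi -> 0 <= t -> Phi t = y -> ginv Phi y = t.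
Proof.
move=> UP t0 ty; rewrite /ginv.
have -> : [set s : R | 0 <= s /\ Phi s <= y] = [set s : R | 0 <= s <= t].
  apply/seteqP; split=> s /= [s0 H]; split=> //.
    by apply: (inU_le_inv Phi) => //; rewrite ty.
  by rewrite -ty; apply: (inU_growth _ UP).2.1.
apply/eqP; rewrite eq_le; apply/andP; split.
  apply: ge_sup; first by exists t => /=; split=> //; exact: Rle_refl.
  by move=> s /= [_ /RleP].
apply: ub_le_sup; last by split=> //; exact: Rle_refl.
by exists t => s /= [_ /RleP].
Qed.

Lemma ginvP Phi y : inU Phi -> 0 < y -> 0 < ginv Phi y /\ Phi (ginv Phi y) = y.
Proof.
move=> UP y0; have gP := inU_growth _ UP.
have [t [t0 ty]] := gP.2.2.2 y (Rlt_le _ _ y0).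
rewrite (ginv_eq Phi t y) //; split=> //.
by case: t0 ty => // <-; rewrite growth_0 //; lra.
Qed.

Lemma Rpower_inv_pos t e : 0 < / Rpower t e.
Proof. by apply: Rinv_0_lt_compat; exact: exp_pos. Qed.

(** The function 1 / (z - conj a) for a = x0 + i y0, whose pole lies below the real line; the
    denominator has the affine shape of [cderiv_affine]. *)
Definition test_kernel (x0 y0 : R) (z : C) : C := (/ (1 * z + - (x0, Ropp y0)))%C.

Definition test_fun (A x0 y0 : R) (n : nat) (z : C) : C := (A * (y0 * test_kernel x0 y0 z) ^ n)%C.

Lemma test_kernel_shift x0 y0 x y : (1 * (x, y) + - (x0, Ropp y0))%C = (x - x0, y + y0).
Proof. by apply: injective_projections; rewrite /=; ring. Qed.

Lemma shift_neq0 x0 y0 x y : 0 < y0 -> 0 < y -> (x - x0, y + y0) <> RtoC 0.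
Proof. by move=> ? ? []; lra. Qed.

Lemma holo_test_kernel x0 y0 : 0 < y0 -> holo (test_kernel x0 y0).
Proof.
move=> y00; apply: holo_at_holo => x y yp.
eexists; apply: (cderiv_comp (fun w => / w)%C (fun w => 1 * w + - (x0, Ropp y0))%C); last exact: cderiv_affine.
by rewrite test_kernel_shift; apply: cderiv_inv; exact: shift_neq0.
Qed.

Lemma holo_const k : holo (fun=> k).
Proof. by apply: holo_at_holo => x y _; exists 0%C; exact: cderiv_const. Qed.

Lemma holo_pow f n : holo f -> holo (fun z => (f z ^ n)%C).
Proof. by move=> hf; elim: n => [|n IH]; [exact: holo_const|exact: holo_mult]. Qed.

Lemma holo_test_fun A x0 y0 n : 0 < y0 -> holo (test_fun A x0 y0 n).
Proof.
move=> y00; apply: (holo_mult (fun=> RtoC A)); first exact: holo_const.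
apply: (holo_pow (fun z => y0 * test_kernel x0 y0 z)%C).
by apply: (holo_mult (fun=> RtoC y0)); [exact: holo_const|exact: holo_test_kernel].
Qed.

Lemma Cmod_test_kernel x0 y0 x y : 0 < y0 -> 0 < y ->
  Cmod (test_kernel x0 y0 (x, y)) = / sqrt ((x - x0) * (x - x0) + (y + y0) * (y + y0)).
Proof.
move=> y00 yp; rewrite /test_kernel test_kernel_shift Cmod_inv; last exact: shift_neq0.
by rewrite /Cmod /=; congr (/ sqrt _); ring.
Qed.

Lemma Cmod_test_fun A x0 y0 n z : 0 <= A -> 0 < y0 ->
  Cmod (test_fun A x0 y0 n z) = A * (y0 * Cmod (test_kernel x0 y0 z)) ^ n.
Proof.
move=> A0 y00; rewrite /test_fun Cmod_mult Cmod_pow Cmod_mult !Cmod_R !Rabs_pos_eq //; exact: Rlt_le.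
Qed.

Lemma test_fun_diag A x0 y0 n : 0 <= A -> 0 < y0 -> Cmod (test_fun A x0 y0 n (x0, y0)) = A * (/ 2) ^ n.
Proof.
move=> A0 y00; rewrite Cmod_test_fun // Cmod_test_kernel //; congr (_ * _ ^ _).
rewrite (_ : _ + _ = (2 * y0) * (2 * y0)); last by ring.
by rewrite sqrt_square; [field|]; lra.
Qed.

(** Two powers of the kernel are kept exactly, since they form the Poisson kernel up to the factor y
    + y0; the other powers are estimated by the second bound, which does not involve x. *)
Lemma Cmod_test_kernel_bounds x0 y0 x y : 0 < y0 -> 0 < y ->
  Cmod (test_kernel x0 y0 (x, y)) * Cmod (test_kernel x0 y0 (x, y)) = / ((x - x0) * (x - x0) + (y + y0) * (y + y0)) /\
  Cmod (test_kernel x0 y0 (x, y)) <= / (y + y0).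
Proof.
move=> y00 yp; rewrite Cmod_test_kernel //.
have X2 : 0 <= (x - x0) * (x - x0) by exact: Rle_0_sqr.
have Y2 : 0 < (y + y0) * (y + y0) by apply: Rmult_lt_0_compat; lra.
split; first by rewrite -Rinv_mult sqrt_sqrt //; lra.
apply: Rinv_le_contravar; first lra.
by rewrite -{1}(sqrt_square (y + y0)); [apply: sqrt_le_1; lra|lra].
Qed.

(* The density is majorised by the product of the weight with the Poisson kernel of the half-plane. *)
Lemma dens_test_fun_le Phi al L A x0 y0 n x y : inU Phi -> 1 <= L -> 0 < y0 -> 0 < y -> 0 < al + 1 ->
  al + 1 <= INR n -> 0 < A -> Phi A = / Rpower y0 (2 + al) ->
  dens Phi al L (test_fun A x0 y0 (n + 2)) (x, y) <=
  / L * test_weight al y0 y * (y + y0) * (Cmod (test_kernel x0 y0 (x, y)) * Cmod (test_kernel x0 y0 (x, y))).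
Proof.
move=> UP L1 y00 yp al1 nal A0 PA.
rewrite /dens Cmod_test_fun //; last exact: Rlt_le.
have [ks kY] := Cmod_test_kernel_bounds x0 y0 x y y00 yp.
have k0 := Cmod_ge_0 (test_kernel x0 y0 (x, y)).
set k := Cmod _ in ks kY k0 *; set Y := y + y0; have Yp : 0 < Y by rewrite /Y; lra.
have t01 : 0 <= y0 * k <= 1.
  split; first by apply: Rmult_le_pos; lra.
  apply: (Rle_trans _ (y0 * / Y)); first by apply: Rmult_le_compat_l; [lra|exact: kY].
  by apply: (Rmult_le_reg_r Y) => //; rewrite Rmult_assoc Rinv_l; rewrite /Y; lra.
(* The quotient y0 / Y is below 1, so the n powers may be reduced to the real exponent al + 1, which
   makes the powers of y0 and Y match [test_weight] exactly. *)
have tn : (y0 * k) ^ n <= Rpower (y0 / Y) (al + 1).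
  have q0 : 0 < y0 / Y by exact: Rdiv_lt_0_compat.
  apply: (Rle_trans _ ((y0 / Y) ^ n)).
    apply: pow_incr; split; first by case: t01.
    by apply: Rmult_le_compat_l; [lra|exact: kY].
  rewrite -Rpower_pow //; apply: Rpower_le_exponent => //; split=> //.
  by apply: (Rmult_le_reg_r Y) => //; rewrite /Rdiv Rmult_assoc Rinv_l; rewrite /Y; lra.
set tau := (y0 * k) ^ (n + 2).
have tau01 : 0 <= tau <= 1.
  split; first by apply: pow_le; case: t01.
  by rewrite -(pow1 (n + 2)); apply: pow_incr.
have tauE : tau <= Rpower (y0 / Y) (al + 1) * (y0 * y0 * (k * k)).
  rewrite /tau pow_add (_ : (y0 * k) ^ 2 = y0 * y0 * (k * k)); last by rewrite /=; ring.
  apply: Rmult_le_compat_r => //; apply: Rmult_le_pos; first by apply: Rmult_le_pos; lra.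
  by apply: Rmult_le_pos.
have Li : 0 < / L by apply: Rinv_0_lt_compat; lra.
have Li1 : / L <= 1 by rewrite -Rinv_1; apply: Rinv_le_contravar; lra.
have P1 : Phi (A * tau / L) <= tau * / L * / Rpower y0 (2 + al).
  rewrite -PA (_ : A * tau / L = tau * / L * A); last by rewrite /Rdiv; ring.
  apply: inU_scale => //; last lra.
  split; first by apply: Rmult_le_pos; lra.
  by rewrite -[X in _ <= X]Rmult_1_r; apply: Rmult_le_compat; lra.
apply: (Rle_trans _ (tau * / L * / Rpower y0 (2 + al) * Rpower y al)).
  by apply: Rmult_le_compat_r => //; left; exact: exp_pos.
apply: (Rle_trans _ (Rpower (y0 / Y) (al + 1) * (y0 * y0 * (k * k)) * / L * / Rpower y0 (2 + al) * Rpower y al)).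
  apply: Rmult_le_compat_r; first by left; exact: exp_pos.
  apply: Rmult_le_compat_r; first by left; exact: Rpower_inv_pos.
  by apply: Rmult_le_compat_r; first by left.
right; rewrite /test_weight -/Y !Rpower_div // Rpower_1_add // Rpower_1_add // Rpower_2_add //.
have := Rpower_pos y0 al; have := Rpower_pos Y al => ? ?.
by field; repeat split; lra.
Qed.

(** Tonelli with x inside: the Poisson kernel contributes at most pi at each height, and
    [test_weight] then at most 1 / (al + 1). The gauge L outweighs the product, uniformly in the
    point a. *)
Lemma PhiInt_test_fun_le Phi al L A x0 y0 n : inU Phi -> 1 <= L -> PI * / (al + 1) <= L -> 0 < y0 -> 0 < al + 1 ->
  al + 1 <= INR n -> 0 < A -> Phi A = / Rpower y0 (2 + al) ->
  (PhiInt Phi al L (test_fun A x0 y0 (n + 2)) <= 1)%E.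
Proof.
move=> UP L1 LPI y00 al1 nal A0 PA; have L0 : 0 < L by lra.
have Li : 0 < / L by exact: Rinv_0_lt_compat.
set V := fun y => / L * test_weight al y0 y * (y + y0).
set g : MR2 -> R := fun z => V z.2 * (Cmod (test_kernel x0 y0 z) * Cmod (test_kernel x0 y0 z)).
have V0 y : 0 < y -> 0 <= V y.
  move=> yp; apply: Rmult_le_pos; last lra.
  by apply: Rmult_le_pos; [lra|exact: test_weight_ge0].
have g0 z : upper z -> 0 <= g z.
  by move=> uz; apply: Rmult_le_pos; [exact: V0|apply: Rmult_le_pos; exact: Cmod_ge_0].
have mg : measurable_fun [set z : MR2 | upper z] (g : MR2 -> MR).
  apply: measurable_funM.
    apply: (measurable_snd_continuous V) => y yp; apply/continuity_pt_filterlim.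
    apply: (continuous_mult (K := R_AbsRing)).
      by apply: (continuous_scal_r (V := R_NormedModule) (/ L)); exact: test_weight_continuous.
    by apply: (continuous_plus (V := R_NormedModule)); [exact: continuous_id|exact: continuous_const].
  by apply: measurable_funM; apply: measurable_Cmod; [exact: box_open_upper|exact: holo_holo_at (holo_test_kernel x0 y0 y00)|exact: box_open_upper|exact: holo_holo_at (holo_test_kernel x0 y0 y00)].
apply: (@le_trans _ _ (\int[leb2]_(z in [set z : MR2 | upper z]) (g z)%:E)%E).
  rewrite PhiIntE; apply: ge0_le_integral.
  - exact: measurable_upper.
  - by move=> z _; rewrite lee_fin; apply/RleP; apply: dens_ge0 => //; exact: inU_growth.
  - by apply/measurable_EFinP; apply: measurable_dens => //; [exact: inU_growth|exact: holo_test_fun].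
  - exact/measurable_EFinP.
  - by case=> x y uz; rewrite lee_fin; apply/RleP; exact: (dens_test_fun_le Phi).
pose h : MR2 -> \bar R := (fun z : MR2 => (g z)%:E) \_ [set z : MR2 | upper z].
have mh : measurable_fun setT h.
  by apply: (measurable_restrictT _ measurable_upper).1; exact/measurable_EFinP.
have h0 z : (0 <= h z)%E.
  by apply: erestrict_ge0 => x ux; rewrite lee_fin; apply/RleP; exact: g0.
rewrite integral_mkcond -/h fubini_tonelli2 //.
have mG := @measurable_fun_fubini_tonelli_G _ _ MR MR R leb h mh h0.
have G0 y : (0 <= fubini_G leb h y)%E by apply: integral_ge0 => x _; exact: h0.
have Gle y : (fubini_G leb h y <= ((fun y => (/ L * PI * test_weight al y0 y)%coqR%:E) \_ (`]0%coqR, +oo[%classic)) y)%E.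
  rewrite /fubini_G patchE; case: ifPn => [|/negP]; rewrite inE /= in_itv /= andbT.
    move=> /RltP yp.
    apply: (@le_trans _ _ ((/ L * test_weight al y0 y) * PI)%coqR%:E); last first.
      by rewrite lee_fin; apply/RleP; right; ring.
    apply: le_trans (integral_poisson_le x0 (y + y0) (/ L * test_weight al y0 y) _ _); last 2 first.
    - lra.
    - by apply: Rmult_le_pos; [lra|exact: test_weight_ge0].
    have -> : (\int[leb]_x h (x, y) = \int[leb]_(x in setT) (/ L * test_weight al y0 y * ((y + y0) / ((x - x0) * (x - x0) + (y + y0) * (y + y0))))%coqR%:E)%E.
      apply: eq_integral => x _; rewrite /h patchE mem_set //.
      rewrite /g (Cmod_test_kernel_bounds x0 y0 x y y00 yp).1 /V /=; congr (EFin _).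
      by rewrite /Rdiv; exact: Rmult_assoc.
    exact: le_refl.
  move=> ny; rewrite integral0_eq // => x _; rewrite /h patchE memNset // => uy; apply: ny.
  exact/RltP.
apply: (@le_trans _ _ (\int[leb]_y (((fun y => (/ L * PI * test_weight al y0 y)%coqR%:E) \_ (`]0%coqR, +oo[%classic)) y))%E).
  apply: ge0_le_integral => //.
  apply: (measurable_restrictT _ _).1; first exact: measurable_itv.
  by apply/measurable_EFinP; exact: measurable_test_weight.
rewrite -integral_mkcond.
apply: (le_trans (integral_test_weight_le al y0 (/ L * PI) y00 al1 _)).
  by apply: Rmult_le_pos; [lra|have := PI_RGT_0; lra].
rewrite lee_fin; apply/RleP; apply: (Rmult_le_reg_l L) => //.
rewrite -!Rmult_assoc Rinv_r; last lra.
by rewrite Rmult_1_l; change (PI * / (al + 1) <= L * 1); lra.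
Qed.

(** * Luxemburg gauges and multipliers *)

Lemma PhiInt_scale_le Phi Psi gam del lam mu f g K : growth Phi -> growth Psi -> holo f -> holo g ->
  0 < lam -> 0 < mu -> 0 < K ->
  (forall z, upper z -> dens Phi gam lam f z <= K * dens Psi del mu g z) ->
  (PhiInt Phi gam lam f <= K%:E * PhiInt Psi del mu g)%E.
Proof.
move=> gP gQ hf hg l0 m0 K0 H; rewrite !PhiIntE.
have mg : measurable_fun [set z : MR2 | upper z] (fun z => (dens Psi del mu g z)%:E).
  by apply/measurable_EFinP; exact: measurable_dens.
rewrite -ge0_integralZl //; last 3 first.
- exact: measurable_upper.
- by move=> z _; rewrite lee_fin; apply/RleP; exact: dens_ge0.
- by rewrite lee_fin; apply/RleP; exact: Rlt_le.
apply: ge0_le_integral.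
- exact: measurable_upper.
- by move=> z _; rewrite lee_fin; apply/RleP; exact: dens_ge0.
- by apply/measurable_EFinP; exact: measurable_dens.
- exact: measurable_funeM.
- by move=> z uz; rewrite -EFinM lee_fin; apply/RleP; exact: H.
Qed.

Lemma PhiInt_ge0 Phi gam lam f : growth Phi -> 0 < lam -> (0 <= PhiInt Phi gam lam f)%E.
Proof.
by move=> gP l0; rewrite PhiIntE; apply: integral_ge0 => z _; rewrite lee_fin; apply/RleP; exact: dens_ge0.
Qed.

(** Membership in the space is tested at gauge 1, while the estimates produce another gauge; the
    upper type condition passes from one to the other. *)
Lemma PhiInt_le1_finite Phi gam mu f : inU Phi -> holo f -> 0 < mu ->
  (PhiInt Phi gam mu f <= 1)%E -> (PhiInt Phi gam 1 f < +oo)%E.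
Proof.
move=> UP hf m0 int1; have gP := inU_growth _ UP.
have [K [K0 HK]] := inU_dilate Phi (Rmax 1 mu) UP (Rmax_l _ _).
have := PhiInt_scale_le Phi Phi gam gam 1 mu f f K gP gP hf hf Rlt_0_1 m0 K0.
move=> H; apply: (@le_lt_trans _ _ (K%:E * PhiInt Phi gam mu f)%E); last first.
  apply: (@le_lt_trans _ _ (K%:E * 1)%E); last by rewrite mule1 ltry.
  by apply: lee_wpmul2l => //; rewrite lee_fin; apply/RleP; exact: Rlt_le.
apply: H => z _; rewrite /dens -Rmult_assoc; apply: Rmult_le_compat_r; first by left; exact: exp_pos.
have c0 := Cmod_ge_0 (f z).
have q0 : 0 <= Cmod (f z) / mu by exact: Rle_mult_inv_pos.
apply: Rle_trans (HK _ q0); apply: gP.2.1; first by lra.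
rewrite (_ : Cmod (f z) / 1 = Cmod (f z) / mu * mu); last by field; lra.
by apply: Rmult_le_compat_l => //; exact: Rmax_r.
Qed.

(** If r is the modular at gauge 1, the gauge 1 + r is admissible because Phi(s / (1 + r)) <= Phi(s)
    / (1 + r). Hence the infimum defining [lux] is taken over a nonempty set. *)
Lemma inA_lux_nonempty Phi gam f : inU Phi -> inA Phi gam f ->
  exists lam, 0 < lam /\ (PhiInt Phi gam lam f <= 1)%E.
Proof.
move=> UP [hf fin]; have gP := inU_growth _ UP.
have : PhiInt Phi gam 1 f \is a fin_num by rewrite ge0_fin_numE // PhiInt_ge0 //; exact: Rlt_0_1.
case/fineK; set r := fine _ => rE.
have r0 : 0 <= r by apply/RleP; rewrite -lee_fin rE; apply: PhiInt_ge0 => //; exact: Rlt_0_1.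
have l0 : 0 < 1 + r by lra.
have Li : 0 < / (1 + r) by exact: Rinv_0_lt_compat.
exists (1 + r); split=> //.
have := PhiInt_scale_le Phi Phi gam gam (1 + r) 1 f f (/ (1 + r)) gP gP hf hf l0 Rlt_0_1 Li.
move=> H; apply: (le_trans (H _)); last first.
  rewrite -rE -EFinM lee_fin; apply/RleP; apply: (Rmult_le_reg_l (1 + r)) => //.
  by rewrite -Rmult_assoc Rinv_r; [change (1 * r <= (1 + r) * 1)|]; lra.
move=> z _; rewrite /dens -Rmult_assoc; apply: Rmult_le_compat_r; first by left; exact: exp_pos.
rewrite (_ : Cmod (f z) / (1 + r) = / (1 + r) * (Cmod (f z) / 1)); last by field; lra.
apply: inU_scale => //; last by apply: Rle_mult_inv_pos; [exact: Cmod_ge_0|lra].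
by split; [lra|rewrite -Rinv_1; apply: Rinv_le_contravar; lra].
Qed.

Lemma lux_le Phi gam lam f : 0 < lam -> (PhiInt Phi gam lam f <= 1)%E -> lux Phi gam f <= lam.
Proof.
move=> l0 H; apply/RleP; apply: ge_inf; last by split.
by exists 0%coqR => x [x0 _]; apply/RleP; exact: Rlt_le.
Qed.

Lemma le_lux Phi gam f M : inU Phi -> inA Phi gam f ->
  (forall lam, 0 < lam -> (PhiInt Phi gam lam f <= 1)%E -> M <= lam) -> M <= lux Phi gam f.
Proof.
move=> UP /(inA_lux_nonempty _ _ _ UP) [l Hl] H; apply/RleP; apply: lb_le_inf; first by exists l.
by move=> x [x0 Hx]; apply/RleP; exact: H.
Qed.

Lemma lux_lt Phi gam f M : inU Phi -> inA Phi gam f -> lux Phi gam f < M ->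
  exists lam, 0 < lam /\ lam < M /\ (PhiInt Phi gam lam f <= 1)%E.
Proof.
move=> UP fA lM; apply: contrapT => nex.
have : M <= lux Phi gam f; last lra.
apply: le_lux => // lam l0 Hl; apply: Rnot_lt_le => lamM; apply: nex; exists lam; split=> //; split=> //.
Qed.

(** A constant K >= 1 in front of Phi(A) can be moved inside, K Phi(A) <= Phi(K A), after which Phi
    can be inverted. *)
Lemma pointwise_ginv gam : exists c, 1 <= c /\ forall Phi F lam p q, inU Phi -> holo F ->
  0 < lam -> (PhiInt Phi gam lam F <= 1)%E -> 0 < q ->
  Cmod (F (p, q)) <= c * lam * ginv Phi (/ Rpower q (2 + gam)).
Proof.
have [c [c0 Hc]] := pointwise_estimate gam.
have K1 := Rmax_l 1 c; have K2 := Rmax_r 1 c; set K := Rmax 1 c in K1 K2.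
exists (128 * K); split; first lra.
move=> Phi F lam p q UP hF l0 H q0.
have [A0 AE] := ginvP Phi _ UP (Rpower_inv_pos q (2 + gam)).
set A := ginv _ _ in A0 AE *.
have P := Hc Phi F lam p q UP hF l0 H q0; rewrite -AE in P.
have PA := inU_pos _ _ UP A0.
have Ki : 0 < / K by apply: Rinv_0_lt_compat; lra.
have S : Phi A <= / K * Phi (K * A).
  rewrite {1}(_ : A = / K * (K * A)); last by field; lra.
  apply: inU_scale => //; last by apply: Rmult_le_pos; lra.
  by split; [lra|rewrite -Rinv_1; apply: Rinv_le_contravar; lra].
have L : Cmod (F (p, q)) / (128 * lam) <= K * A.
  apply: (inU_le_inv Phi) => //.
  - by apply: Rle_mult_inv_pos; [exact: Cmod_ge_0|lra].
  - by apply: Rmult_le_pos; lra.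
  apply: (Rle_trans _ (K * Phi A)); first by apply: (Rle_trans _ _ _ P); apply: Rmult_le_compat_r; lra.
  rewrite (_ : Phi (K * A) = K * (/ K * Phi (K * A))); last by field; lra.
  by apply: Rmult_le_compat_l; lra.
rewrite (_ : Cmod (F (p, q)) = 128 * lam * (Cmod (F (p, q)) / (128 * lam))); last by field; lra.
rewrite (_ : 128 * K * lam * A = 128 * lam * (K * A)); last by ring.
by apply: Rmult_le_compat_l; lra.
Qed.

Section multipliers.
Variables (Phi1 Phi2 : R -> R) (al be : R).
Hypotheses (U1 : inU Phi1) (U2 : inUtilde Phi2).
Hypothesis ratio : forall s t, 0 < s -> s <= t -> Phi2 s / Phi1 s <= Phi2 t / Phi1 t.
Hypothesis al1 : -1 < al.

Let U2' : inU Phi2 := inUtilde_inU _ U2.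

Lemma omega_pos t : 0 < omega Phi1 Phi2 al be t.
Proof.
apply: Rdiv_lt_0_compat; first exact: (ginvP Phi2 _ U2' (Rpower_inv_pos _ _)).1.
exact: (ginvP Phi1 _ U1 (Rpower_inv_pos _ _)).1.
Qed.

Lemma Hinfty_w_multiplier g : Hinfty_w (omega Phi1 Phi2 al be) g -> multiplier Phi1 al Phi2 be g.
Proof.
move=> [hg [M0 HM0]]; split=> //.
have M1 := Rmax_l 1 M0; have M2 := Rmax_r 1 M0; set M := Rmax 1 M0 in M1 M2.
have HM z : upper z -> Cmod (g z) / M <= omega Phi1 Phi2 al be (snd z).
  move=> uz; have w0 := omega_pos (snd z); have := HM0 z uz.
  set w := omega _ _ _ _ _ in w0 * => H.
  have H' : Cmod (g z) <= M * w.
    rewrite (_ : Cmod (g z) = Cmod (g z) / w * w); last by field; lra.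
    by apply: Rmult_le_compat_r; lra.
  apply: (Rmult_le_reg_r M); first lra.
  by rewrite /Rdiv Rmult_assoc Rinv_l; lra.
have [c [c1 Hc]] := pointwise_ginv al.
have [D [D1 HD]] := multiplier_pointwise Phi1 Phi2 U1 U2 ratio.
have C0 : 0 < c * M * D by repeat apply: Rmult_lt_0_compat; lra.
(* The factor c brings |f| below A, M brings |g| below B / A, and D is the loss of
   [multiplier_pointwise]. *)
exists (c * M * D); split=> // f fA; have hf := fA.1.
have hfg : holo (fun z => (f z * g z)%C) by exact: holo_mult.
(* Every admissible gauge of f, multiplied by c M D, is admissible for f g. Both membership of f g
   and the norm inequality follow. *)
have key lam : 0 < lam -> (PhiInt Phi1 al lam f <= 1)%E ->
    (PhiInt Phi2 be (c * M * D * lam) (fun z => (f z * g z)%C) <= 1)%E.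
  move=> l0 Hl; apply: (le_trans _ Hl); apply: le_dens_PhiInt => //.
  - exact: inU_growth.
  - exact: inU_growth.
  - exact: Rmult_lt_0_compat.
  case=> x y yp; rewrite /upper /= in yp.
  have [A0 AE] := ginvP Phi1 _ U1 (Rpower_inv_pos y (2 + al)).
  have [B0 BE] := ginvP Phi2 _ U2' (Rpower_inv_pos y (2 + be)).
  have P := Hc Phi1 f lam x y U1 hf l0 Hl yp.
  have W := HM (x, y) yp; rewrite /omega /= in W.
  set A := ginv Phi1 _ in A0 AE P W; set B := ginv Phi2 _ in B0 BE W.
  have f0 := Cmod_ge_0 (f (x, y)); have g0 := Cmod_ge_0 (g (x, y)).
  have cl : 0 < c * lam by apply: Rmult_lt_0_compat; lra.
  have u0 : 0 <= Cmod (f (x, y)) / (c * lam) <= A.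
    split; first exact: Rle_mult_inv_pos.
    apply: (Rmult_le_reg_r (c * lam)) => //.
    by rewrite /Rdiv Rmult_assoc Rinv_l; lra.
  have w0 : 0 <= Cmod (g (x, y)) / M <= B / A by split=> //; apply: Rle_mult_inv_pos; lra.
  have := HD A B _ _ A0 B0 u0 w0; rewrite AE BE => H.
  rewrite /dens /= Cmod_mult.
  rewrite (_ : Cmod (f (x, y)) * Cmod (g (x, y)) / (c * M * D * lam) =
    Cmod (f (x, y)) / (c * lam) * (Cmod (g (x, y)) / M) / D); last by field; repeat split; lra.
  apply: (Rle_trans _ (Phi1 (Cmod (f (x, y)) / (c * lam)) * (/ Rpower y (2 + be) / / Rpower y (2 + al)) * Rpower y be)).
    by apply: Rmult_le_compat_r => //; left; exact: exp_pos.
  rewrite !Rpower_2_add //.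
  have a0 := Rpower_pos y al; have b0 := Rpower_pos y be.
  rewrite (_ : Phi1 _ * _ * _ = Phi1 (Cmod (f (x, y)) / (c * lam)) * Rpower y al); last by field; repeat split; lra.
  apply: Rmult_le_compat_r; first lra.
  apply: (inU_growth _ U1).2.1; first by case: u0.
  apply: Rmult_le_compat_l => //; apply: Rinv_le_contravar => //.
  by rewrite -{1}(Rmult_1_l lam); apply: Rmult_le_compat_r; lra.
split.
  split=> //; have [lam [l0 Hl]] := inA_lux_nonempty _ _ _ U1 fA.
  by apply: (PhiInt_le1_finite _ _ (c * M * D * lam)); [exact: U2'|exact: hfg|exact: Rmult_lt_0_compat|exact: key].
have := le_lux Phi1 al f (lux Phi2 be (fun z => (f z * g z)%C) / (c * M * D)) U1 fA.
set l2 := lux Phi2 _ _; set l1 := lux Phi1 _ _ => H.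
have : l2 / (c * M * D) <= l1.
  apply: H => lam l0 Hl; apply: (Rmult_le_reg_l (c * M * D)) => //.
  rewrite (_ : c * M * D * (l2 / (c * M * D)) = l2); last by field; repeat split; lra.
  by apply: lux_le; [exact: Rmult_lt_0_compat|exact: key].
move=> /(Rmult_le_compat_l _ _ _ (Rlt_le _ _ C0)).
by rewrite (_ : c * M * D * (l2 / (c * M * D)) = l2) //; field; repeat split; lra.
Qed.

Lemma multiplier_Hinfty_w g : multiplier Phi1 al Phi2 be g -> Hinfty_w (omega Phi1 Phi2 al be) g.
Proof.
move=> [hg [C [C0 HC]]]; split=> //.
have [c [c1 Hc]] := pointwise_ginv be.
have ap : 0 < al + 1 by lra.
have [n Hn] := INR_unbounded (al + 1).
have L1 := Rmax_l 1 (PI * / (al + 1)); have L2 := Rmax_r 1 (PI * / (al + 1)).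
set L := Rmax _ _ in L1 L2; have L0 : 0 < L by lra.
(* The [+ 1] makes the bound on the norm of the product strict, so that an admissible gauge below C
   L + 1 exists; 2^(n+2) undoes the value A / 2^(n+2) of the test function at a. *)
exists (c * (C * L + 1) * 2 ^ (n + 2)) => -[p q] qp; rewrite /upper /= in qp; rewrite /=.
have [A0 AE] := ginvP Phi1 _ U1 (Rpower_inv_pos q (2 + al)).
have [B0 BE] := ginvP Phi2 _ U2' (Rpower_inv_pos q (2 + be)).
rewrite /omega; set A := ginv Phi1 _ in A0 AE *; set B := ginv Phi2 _ in B0 BE *.
set T := test_fun A p q (n + 2).
have hT : holo T by exact: holo_test_fun.
have IT : (PhiInt Phi1 al L T <= 1)%E by apply: PhiInt_test_fun_le => //; lra.
have AT : inA Phi1 al T by split=> //; exact: (PhiInt_le1_finite Phi1 al L).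
have [ATg LTg] := HC T AT.
have LT : lux Phi1 al T <= L by exact: lux_le.
have lt : lux Phi2 be (fun z => (T z * g z)%C) < C * L + 1.
  by have : C * lux Phi1 al T <= C * L; [apply: Rmult_le_compat_l; lra|lra].
have [lam [l0 [l1 Hl]]] := lux_lt Phi2 be _ _ U2' ATg lt.
have := Hc Phi2 _ lam p q U2' (holo_mult T g hT hg) l0 Hl qp.
rewrite -/B Cmod_mult test_fun_diag //; last lra.
have p2 : 0 < 2 ^ (n + 2) by apply: pow_lt; lra.
rewrite pow_inv => H.
have g0 := Cmod_ge_0 (g (p, q)).
have H' : c * lam * B <= c * (C * L + 1) * B.
  by apply: Rmult_le_compat_r; [lra|apply: Rmult_le_compat_l; lra].
apply: (Rmult_le_reg_r (B * / 2 ^ (n + 2))).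
  by apply: Rmult_lt_0_compat => //; exact: Rinv_0_lt_compat.
rewrite (_ : _ / (B / A) * _ = A * / 2 ^ (n + 2) * Cmod (g (p, q))); last by field; repeat split; lra.
rewrite (_ : c * _ * _ * _ = c * (C * L + 1) * B); last by field; lra.
lra.
Qed.

Lemma multiplier_iff g : multiplier Phi1 al Phi2 be g <-> Hinfty_w (omega Phi1 Phi2 al be) g.
Proof. by split; [exact: multiplier_Hinfty_w|exact: Hinfty_w_multiplier]. Qed.

End multipliers.

(** * Weights that are bounded, or vanish at the boundary *)

Lemma Hinfty_w_bounded w g c C : 0 < c -> (forall t, 0 < t -> c <= w t /\ w t <= C) -> Hinfty_w w g <-> Hinfty g.
Proof.
move=> c0 Hw; split=> -[hg [M HM]]; split=> //.
  exists (Rmax 0 M * C) => z uz; have [w1 w2] := Hw (snd z) uz.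
  rewrite (_ : Cmod (g z) = Cmod (g z) / w (snd z) * w (snd z)); last by field; lra.
  have m1 := Rmax_l 0 M; have m2 := Rmax_r 0 M; have := HM z uz => ?.
  apply: Rmult_le_compat; [|lra|lra|lra].
  by apply: Rle_mult_inv_pos; [exact: Cmod_ge_0|lra].
exists (Rmax 0 M / c) => z uz; have [w1 w2] := Hw (snd z) uz.
have m1 := Rmax_l 0 M; have m2 := Rmax_r 0 M; have := HM z uz => ?.
apply: Rmult_le_compat; [exact: Cmod_ge_0| |lra|exact: Rinv_le_contravar].
by left; apply: Rinv_0_lt_compat; lra.
Qed.

Lemma Hinfty_w_vanishing w g : (forall t, 0 < t -> 0 < w t) ->
  (forall s t, 0 < s -> s <= t -> w s <= w t) -> (w x @[x --> (0 : R)^'+] --> (0 : R)) ->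
  Hinfty_w w g <-> (holo g /\ forall z, upper z -> g z = 0%C).
Proof.
move=> w0 wm wl; split=> -[hg]; last first.
  move=> g0; split=> //; exists 0 => z uz; rewrite g0 // Cmod_0 /Rdiv Rmult_0_l; exact: Rle_refl.
move=> [M0 HM0]; split=> //.
have M1 := Rmax_l 0 M0; have M2 := Rmax_r 0 M0; set M := Rmax 0 M0 in M1 M2.
have HM x y : 0 < y -> Cmod (g (x, y)) <= M * w y.
  move=> yp; have wy := w0 y yp; have /= H := HM0 (x, y) yp.
  rewrite (_ : Cmod (g (x, y)) = Cmod (g (x, y)) / w y * w y); last by field; lra.
  by apply: Rmult_le_compat_r; lra.
case=> p q qp; rewrite /upper /= in qp.
(* Monotonicity of w bounds g on the strip of heights up to 2 q, and the limit at 0 makes g small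
   near the real line uniformly in x. *)
apply: (holo_zero_of_small_side g p q (M * w (2 * q))) => //.
  move=> x y [yp y2]; apply: (Rle_trans _ _ _ (HM x y yp)).
  by apply: Rmult_le_compat_l; [lra|exact: wm].
move=> eps eps0; have Mp : 0 < M + 1 by lra.
have e0 : 0 < eps / (M + 1) by exact: Rdiv_lt_0_compat.
have := (@cvgrPdist_lt R R^o R _ _ w 0).1 wl (eps / (M + 1)).
move=> lim_w; have [d /RltP d0 Hd] := lim_w _ (introT RltP e0).
exists d; split=> // x y [yp yd]; apply: (Rle_trans _ _ _ (HM x y yp)).
have : w y < eps / (M + 1).
  have := Hd y _ (introT RltP yp).
  rewrite /= -!RabsE => /(_ _)/RltP H.
  have wy := w0 y yp.
  have : Rabs (0 - w y) < eps / (M + 1).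
    by apply: H; apply/RltP; change (Rabs (0 - y) < d); rewrite Rabs_minus_sym Rminus_0_r Rabs_pos_eq; lra.
  by rewrite Rabs_minus_sym Rminus_0_r Rabs_pos_eq; lra.
move=> H; have wy := w0 y yp.
rewrite (_ : eps = (M + 1) * (eps / (M + 1))); last by field; lra.
by apply: Rmult_le_compat; lra.
Qed.

Theorem theorem2p6 (Phi1 Phi2 : R -> R) (al be : R) :
  inU Phi1 -> inUtilde Phi2 ->
  (forall s t, 0 < s -> s <= t -> Phi2 s / Phi1 s <= Phi2 t / Phi1 t) ->
  -1 < al -> -1 < be ->
  (* (i) *)
  (nabla2 Phi1 ->
   (exists c C, 0 < c /\ c <= C /\
      forall t, 0 < t -> c <= omega Phi1 Phi2 al be t <= C) ->
   forall g, multiplier Phi1 al Phi2 be g <-> Hinfty g) /\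
  (* (ii) *)
  ((forall s t, 0 < s -> s <= t -> omega Phi1 Phi2 al be s <= omega Phi1 Phi2 al be t) ->
   (omega Phi1 Phi2 al be x @[x --> (0 : R)^'+] --> (0 : R)) ->
   forall g, multiplier Phi1 al Phi2 be g <-> (holo g /\ forall z, upper z -> g z = 0%C)) /\
  (* (iii) *)
  (nabla2 Phi1 -> nabla2 (fun t => Phi2 (ginv Phi1 t)) ->
   (forall s t, 0 < s -> s <= t -> omega Phi1 Phi2 al be t <= omega Phi1 Phi2 al be s) ->
   forall g, multiplier Phi1 al Phi2 be g <-> Hinfty_w (omega Phi1 Phi2 al be) g).
Proof.
move=> U1 U2 ratio al1 _; have iff_w := multiplier_iff Phi1 Phi2 al be U1 U2 ratio al1.
split; last split.
- move=> _ [c [C [c0 [_ H]]]] g; apply: (iff_trans (iff_w g)).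
  exact: (Hinfty_w_bounded _ _ c C).
- move=> wm wl g; apply: (iff_trans (iff_w g)); apply: Hinfty_w_vanishing => // t _.
  exact: omega_pos.
- by move=> _ _ _ g; exact: iff_w.
Qed.
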